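(* Let $A\in L(\ell^2(\mathbb R))$ be self-adjoint and positive definite, and denote its induced operator on $\ell^2(\mathcal H)$ again by $A$. Let $f\in\ell^2(\mathcal H)$, $n\in\mathbb N$, and let $x_1,\dots,x_n\in\ell^2(\mathbb R)$ be orthonormal with respect to $(\cdot,\cdot)_A$. Then in $L^2(\mu_A)$ $$\mathbb E[\langle f,\cdot\rangle|x_1,\dots,x_n]=\sum_{k=1}^n\big\langle[f,Ax_k]\bullet x_k,\cdot\big\rangle=\langle Pf,\cdot\rangle,$$ where $P:\ell^2(\mathbb R)\to\mathrm{span}\{x_1,\dots,x_n\}$ is the orthogonal projection with respect to $(\cdot,\cdot)_A$ (and $Pf$ is formed with the operator on $\ell^2(\mathcal H)$ induced by $P$). In particular $\mathbb E[\langle f,\cdot\rangle|x_1,\dots,x_n]=\sum_{k=1}^n\mathbb E[\langle f,\cdot\rangle|x_k]$.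
   Context: Setting. $\mathcal H$ is a real separable infinite-dimensional Hilbert space and $\mathcal N\subset\mathcal H\subset\mathcal N'$ a Gel'fand triple, i.e. $\mathcal N$ is a real topological vector space whose topology is given by increasing, compatible Hilbert norms $\|\cdot\|_p$, $p\in\mathbb N_0$ (compatible: a sequence $\|\cdot\|_p$-converging to $0$ and $\|\cdot\|_q$-Cauchy also $\|\cdot\|_q$-converges to $0$), $\mathcal N$ is complete as a metrizable space, its completions $\mathcal N_p$ with respect to $\|\cdot\|_p$ satisfy $\mathcal N_0=\mathcal H$, and the inclusions $\mathcal N_{p+1}\hookrightarrow\mathcal N_p$ are Hilbert–Schmidt. $\ell^2(\mathcal H)$ is the Hilbert space of square summable sequences in $\mathcal H$; $\ell^2_p(\mathcal N_p)=\{f\in\mathcal N_p^{\mathbb N}:\sum_k k^{2p}\|f_k\|_p^2<\infty\}$; $s(\mathcal N):=\bigcap_{p\in\mathbb N_0}\ell_p^2(\mathcal N_p)$ with the topology given by these norms; $s'(\mathcal N)$ is its topological dual with dual pairing $\langle\phi,\omega\rangle=\omega(\phi)$, equipped with the $\sigma$-algebra generated by the maps $\omega\mapsto\langle\phi,\omega\rangle$, $\phi\in s(\mathcal N)$. For $h\in\mathcal H$, $x\in\ell^2(\mathbb R)$, $f\in\ell^2(\mathcal H)$: $h\bullet x:=(x_kh)_{k\in\mathbb N}\in\ell^2(\mathcal H)$ and $[f,x]:=\sum_{k=1}^\infty x_kf_k\in\mathcal H$. A bounded operator $B\in L(\ell^2(\mathbb R))$ induces a bounded operator on $\ell^2(\mathcal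 H)$, again denoted $B$, by $Bf:=\sum_{k=1}^\infty[f,b_k]\bullet Bb_k$ for any orthonormal basis $(b_k)$ of $\ell^2(\mathbb R)$ (independent of the basis). Self-adjointness and positive definiteness ($(x,Bx)>0$ for $x\ne0$) carry over to the induced operator. $(x,y)_A:=(x,Ay)_{\ell^2(\mathbb R)}$ on $\ell^2(\mathbb R)$ and $(f,g)_A:=(f,Ag)_{\ell^2(\mathcal H)}$, $\|f\|_A:=\sqrt{(f,f)_A}$ on $\ell^2(\mathcal H)$. $\mu_A$ is the unique probability measure on $s'(\mathcal N)$ with $\int\exp(i\langle\phi,\omega\rangle)\,d\mu_A(\omega)=\exp(-\tfrac12(\phi,\phi)_A)$ for all $\phi\in s(\mathcal N)$ (Bochner–Minlos); $L^2(\mu_A)=L^2(s'(\mathcal N),\mu_A;\mathbb R)$. $\ell_A^2(\mathcal H)$ is the completion of $\ell^2(\mathcal H)$ with respect to $(\cdot,\cdot)_A$; $s(\mathcal N)$ is dense in it. For $f\in\ell_A^2(\mathcal H)$, $\langle f,\cdot\rangle\in L^2(\mu_A)$ is the $L^2(\mu_A)$-limit of $\langle\phi_k,\cdot\rangle$ for any $\phi_k\in s(\mathcal N)$ with $\phi_k\to f$ in $\ell_A^2(\mathcal H)$. For $F\in L^2(\mu_A)$ and $x_1,\dots,x_n\in\ell^2(\mathbb R)$, $\mathbb E[F|x_1,\dots,x_n]:=\mathbb E[F|\mathcal G]\in L^2(\mu_A)$ with $\mathcal G:=\sigma(\langle h_i\bullet x_k,\cdot\rangle:i\in\mathbb N,k=1,\dots,n)$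 for some orthonormal basis $(h_i)_{i\in\mathbb N}$ of $\mathcal H$; this does not depend on the basis nor on the choice of representatives of the $\langle h_i\bullet x_k,\cdot\rangle$. *)

(* Defs.v *)
From HB Require Import structures.
From mathcomp Require Import all_boot all_order all_algebra.
From mathcomp Require Import all_classical all_reals all_analysis.
From mathcomp Require Import ring lra.

Set Implicit Arguments.
Unset Strict Implicit.
Unset Printing Implicit Defensive.
Import Order.TTheory GRing.Theory Num.Theory.
Import numFieldNormedType.Exports.
Local Open Scope classical_set_scope.
Local Open Scope ring_scope.

HB.mixin Record isHilbert (R : realType) V of CompleteNormedModule R V := {
  dot : V -> V -> R ;
  dotC : forall x y, dot x y = dot y x ;
  dotPl : forall (a : R) x y z, dot (a *: x + y) z = a * dot x z + dot y z ;
  dot_norm : forall x, dot x x = `|x| ^+ 2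
}.

#[short(type="hilbertType")]
HB.structure Definition Hilbert (R : realType) :=
  {V of CompleteNormedModule R V & isHilbert R V}.

Arguments dot {R s}.

Section RHilbert.
Variable R : realType.
Let rdot (x y : R^o) : R := x * y.
Let rdotC x y : rdot x y = rdot y x. Proof. exact: mulrC. Qed.
Let rdotPl (a : R) x y z : rdot (a *: x + y) z = a * rdot x z + rdot y z.
Proof. by rewrite /rdot mulrDl -mulrA. Qed.
Let rdot_norm x : rdot x x = `|x| ^+ 2.
Proof. by rewrite real_normK ?num_real// expr2. Qed.
HB.instance Definition _ := isHilbert.Build R R^o rdotC rdotPl rdot_norm.
End RHilbert.

(* Subspaces and inner products living on a subset of an ambient space. *)
Section Inner.
Context {R : realType} {V : lmodType R}.
Implicit Types (D : set V) (ip : V -> V -> R).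

Definition linear_subspace D :=
  D 0 /\ forall (a : R) x y, D x -> D y -> D (a *: x + y).

Record inner_product_on D ip : Prop := InnerProductOn {
  ip_sym : forall x y, D x -> D y -> ip x y = ip y x ;
  ip_lin : forall (a : R) x y z, D x -> D y -> D z ->
    ip (a *: x + y) z = a * ip x z + ip y z ;
  ip_pos : forall x, D x -> x <> 0 -> 0 < ip x x
}.

Definition ipnorm ip (x : V) : R := Num.sqrt (ip x x).

Definition ip_cvg ip (u : nat -> V) (x : V) :=
  ipnorm ip (u n - x) @[n --> \oo] --> (0 : R).

Definition ip_cauchy ip (u : nat -> V) :=
  forall e : R, 0 < e -> exists N : nat, forall m n : nat,
    (N <= m)%N -> (N <= n)%N -> ipnorm ip (u m - u n) < e.

Definition ip_complete D ip :=
  forall u : nat -> V, (forall n, D (u n)) -> ip_cauchy ip u ->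
  exists2 x, D x & ip_cvg ip u x.

(* An orthonormal sequence in D whose linear span is ip-dense in D. *)
Definition orthonormal_basis_of D ip (e : nat -> V) :=
  [/\ forall k, D (e k),
      forall i j, ip (e i) (e j) = (i == j)%:R &
      forall x (eps : R), D x -> 0 < eps -> exists (n : nat) (c : nat -> R),
        ipnorm ip (x - \sum_(k < n) c k *: e k) < eps].

Section FullInner.
Variable ip : V -> V -> R.
Hypothesis ipH : inner_product_on setT ip.

Let ipC x y : ip x y = ip y x. Proof. exact: (ip_sym ipH). Qed.
Let ipP a x y z : ip (a *: x + y) z = a * ip x z + ip y z.
Proof. exact: (ip_lin ipH). Qed.
Let ip0l z : ip 0 z = 0.
Proof. by have := ipP (-1) 0 0 z; rewrite scaler0 addr0 mulN1r addNr. Qed.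
Let ipDl x y z : ip (x + y) z = ip x z + ip y z.
Proof. by rewrite -[x in LHS]scale1r ipP mul1r. Qed.
Let ipZl a x z : ip (a *: x) z = a * ip x z.
Proof. by rewrite -[a *: x]addr0 ipP ip0l addr0. Qed.

Lemma ip_ge0 x : 0 <= ip x x.
Proof. by have [->|/eqP x0] := eqVneq x 0; rewrite ?ip0l//; apply/ltW/(ip_pos ipH).
Qed.

Lemma ip_CauchySchwarz x y : ip x y ^+ 2 <= ip x x * ip y y.
Proof.
have [->|/eqP y0] := eqVneq y 0; first by rewrite ipC !ip0l mulr0 expr0n.
have y_gt0 : 0 < ip y y by exact: (ip_pos ipH).
have := ip_ge0 (ip y y *: x + (- ip x y) *: y).
rewrite ipDl !ipZl ![ip _ (_ + _)]ipC !ipDl !ipZl [ip y x]ipC => h.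
rewrite -subr_ge0 -(pmulr_rge0 _ y_gt0); apply: le_trans h _.
by rewrite le_eqVlt; apply/orP; left; apply/eqP; ring.
Qed.

Lemma ipnormD x y : ipnorm ip (x + y) <= ipnorm ip x + ipnorm ip y.
Proof.
have s0 : 0 <= ipnorm ip x + ipnorm ip y by rewrite addr_ge0// sqrtr_ge0.
rewrite -[leRHS]ger0_norm// -sqrtr_sqr {1}/ipnorm ler_wsqrtr//.
rewrite ipDl ![ip _ (x + y)]ipC !ipDl [ip y x]ipC sqrrD !sqr_sqrtr ?ip_ge0//.
have : ip x y <= ipnorm ip x * ipnorm ip y.
  rewrite (le_trans (ler_norm _))// -sqrtr_sqr -sqrtrM ?ip_ge0// ler_wsqrtr//.
  exact: ip_CauchySchwarz.
by rewrite mulr2n; lra.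
Qed.

Lemma ipnormZ a x : ipnorm ip (a *: x) = `|a| * ipnorm ip x.
Proof.
by rewrite /ipnorm ipZl ipC ipZl mulrA -expr2 sqrtrM ?sqr_ge0// sqrtr_sqr.
Qed.

Lemma ipnorm_eq0 x : ipnorm ip x = 0 -> x = 0.
Proof.
move=> /eqP; rewrite sqrtr_eq0 => xle0; have [//|/eqP x0] := eqVneq x 0.
by have := ip_pos ipH I x0; rewrite ltNge xle0.
Qed.

End FullInner.

End Inner.

Definition orthonormal_basis {R : realType} {V : hilbertType R} (e : nat -> V) :=
  orthonormal_basis_of setT dot e.

Definition infinite_dimensional {R : realType} (V : lmodType R) :=
  forall (n : nat) (e : 'I_n -> V),
    exists x, forall c : 'I_n -> R, x <> \sum_(i < n) c i *: e i.

Definition separable (T : topologicalType) :=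
  exists2 D : set T, countable D & dense D.

Lemma dot_inner_product {R : realType} {V : hilbertType R} :
  inner_product_on setT (@dot R V).
Proof.
split; [by move=> *; exact: dotC|by move=> *; exact: dotPl|].
by move=> x _ /eqP x0; rewrite dot_norm exprn_gt0// normr_gt0.
Qed.

Section DotTheory.
Context {R : realType} {V : hilbertType R}.
Implicit Types x y z : V.

Lemma dotDl x y z : dot (x + y) z = dot x z + dot y z.
Proof. by rewrite -[x in LHS]scale1r dotPl mul1r. Qed.

Lemma dot_polarization x y :
  dot x y = 2^-1 * (`|x + y| ^+ 2 - `|x| ^+ 2 - `|y| ^+ 2).
Proof.
rewrite -!dot_norm dotDl [dot x (_ + _)]dotC [dot y (_ + _)]dotC !dotDl.
by rewrite [dot y x]dotC; field.
Qed.

Lemma normD2_le x y : `|x + y| ^+ 2 <= 2 * `|x| ^+ 2 + 2 * `|y| ^+ 2.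
Proof.
rewrite (@le_trans _ _ ((`|x| + `|y|) ^+ 2))//.
  by rewrite lerXn2r ?nnegrE ?addr_ge0// ler_normD.
have := sqr_ge0 (`|x| - `|y|); rewrite sqrrB sqrrD !mulr2n; lra.
Qed.

End DotTheory.

Section L2.
Context {R : realType} (H : hilbertType R).

Definition square_summable : {pred nat -> H} :=
  fun f => `[< cvgn (series (fun k => `|f k| ^+ 2)) >].

Lemma square_summable_submod : submod_closed square_summable.
Proof.
split=> [|a f g /asboolP cf /asboolP cg]; apply/asboolP.
  rewrite (_ : (fun k => _) = cst 0); last first.
    by apply/funext => k; rewrite normr0 expr0n.
  rewrite (_ : series _ = cst 0); first exact: is_cvg_cst.
  by apply/funext => n; rewrite /series/= big1.
have cfg : cvgn (series (fun k => 2 * a ^+ 2 * `|f k| ^+ 2 + 2 * `|g k| ^+ 2)).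
  rewrite (_ : series _ = series ((2 * a ^+ 2) *: (fun k => `|f k| ^+ 2) +
                                  2 *: (fun k => `|g k| ^+ 2)))//.
  by apply: is_cvg_seriesD; apply: is_cvg_seriesZ.
apply: series_le_cvg cfg => k /=.
- exact: sqr_ge0.
- by apply: addr_ge0; apply: mulr_ge0; rewrite ?sqr_ge0 ?(mulr_ge0 _ (sqr_ge0 a)).

apply: le_trans (normD2_le _ _) _.
by rewrite normrZ exprMn real_normK ?num_real// mulrA.
Qed.

HB.instance Definition _ :=
  GRing.isSubmodClosed.Build R (nat -> H) square_summable square_summable_submod.

Record l2 := L2 { l2val :> nat -> H ; l2valP : l2val \in square_summable }.

HB.instance Definition _ := [isSub for l2val].
HB.instance Definition _ := [Choice of l2 by <:].
HB.instance Definition _ := [SubChoice_isSubLmodule of l2 by <:].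

Lemma l2_cvg (f : l2) : cvgn (series (fun k => `|f k| ^+ 2)).
Proof. exact/asboolP/(l2valP f). Qed.

Definition l2dot (f g : l2) : R := limn (series (fun k => dot (f k) (g k))).

Lemma l2dot_cvg (f g : l2) : cvgn (series (fun k => dot (f k) (g k))).
Proof.
rewrite (_ : (fun k => _) = 2^-1 *: ((fun k => `|(f + g : l2) k| ^+ 2) -
   (fun k => `|f k| ^+ 2) - (fun k => `|g k| ^+ 2))); last first.
  by apply/funext => k; rewrite dot_polarization.
apply: is_cvg_seriesZ; apply: is_cvg_seriesB; last exact: l2_cvg.
by apply: is_cvg_seriesB; exact: l2_cvg.
Qed.

Lemma l2dot_inner : inner_product_on setT l2dot.
Proof.
split=> [f g _ _|a f g h _ _ _|f _ f0].
- by rewrite /l2dot; under eq_fun do rewrite dotC.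
- rewrite /l2dot -[a * _]/(a *: _) -lim_seriesZ -?lim_seriesD.
  + by congr (limn (series _)); apply/funext => k; rewrite dotPl.
  + apply: is_cvg_seriesZ. exact: l2dot_cvg.
  + exact: l2dot_cvg.
  + exact: l2dot_cvg.
- have [k fk0] : exists k, f k <> 0.
    apply: contrapT => f0'; apply: f0; apply: val_inj => /=.
    by apply: funext => k; apply: contrapT => fk; apply: f0'; exists k.
  have nd : {homo series (fun k => dot (f k) (f k)) : m n / (m <= n)%N >-> m <= n}.
    by apply: nondecreasing_series => i _; rewrite dot_norm sqr_ge0.
  apply: lt_le_trans (nondecreasing_cvgn_le nd (@l2dot_cvg f f) k.+1).
  rewrite /series/= big_nat_recr//= ltr_wpDl//.
    by apply: sumr_ge0 => i _; rewrite dot_norm sqr_ge0.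
  by rewrite dot_norm exprn_gt0// normr_gt0; exact/eqP.
Qed.

Definition l2norm (f : l2) : R := ipnorm l2dot f.

HB.instance Definition _ := Lmodule_isNormed.Build R l2
  (ipnormD l2dot_inner) (ipnormZ l2dot_inner) (ipnorm_eq0 l2dot_inner).

Lemma l2normE (f : l2) : `|f| = ipnorm l2dot f. Proof. by []. Qed.

Lemma l2norm_sqr (f : l2) : l2dot f f = `|f| ^+ 2.
Proof. by rewrite l2normE sqr_sqrtr// (ip_ge0 l2dot_inner). Qed.

Lemma l2_sum_le (f : l2) n : \sum_(0 <= k < n) `|f k| ^+ 2 <= `|f| ^+ 2.
Proof.
have nd : {homo series (fun k => dot (f k) (f k)) : m n / (m <= n)%N >-> m <= n}.
  by apply: nondecreasing_series => i _; rewrite dot_norm sqr_ge0.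
rewrite -l2norm_sqr; apply: le_trans (nondecreasing_cvgn_le nd (@l2dot_cvg f f) n).
by rewrite /series/= le_eqVlt; apply/orP; left; apply/eqP/eq_bigr => k _; rewrite dot_norm.
Qed.

Lemma l2_bound (g : nat -> H) (M : R) :
  (forall n, \sum_(0 <= k < n) `|g k| ^+ 2 <= M) -> g \in square_summable.
Proof.
move=> gM; apply/asboolP; apply: nondecreasing_is_cvgn.
  by apply: nondecreasing_series => i _; rewrite sqr_ge0.
by exists M => _ [n _ <-]; exact: gM.
Qed.

Lemma l2norm_le (f : l2) (M : R) : 0 <= M ->
  (forall n, \sum_(0 <= k < n) `|f k| ^+ 2 <= M ^+ 2) -> `|f| <= M.
Proof.
move=> M0 fM; rewrite -[leLHS]ger0_norm// -[M]ger0_norm// -!sqrtr_sqr.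
rewrite ler_wsqrtr// -l2norm_sqr /l2dot; apply: limr_le; first exact: l2dot_cvg.
apply: nearW => n; apply: le_trans (fM n).
by rewrite /series/= le_eqVlt; apply/orP; left; apply/eqP/eq_bigr => k _; rewrite dot_norm.
Qed.

Lemma l2_coord_le (f : l2) k : `|f k| <= `|f|.
Proof.
rewrite -(@ler_pXn2r _ 2)// ?nnegrE//; apply: le_trans (l2_sum_le f k.+1).
by rewrite big_nat_recr//= lerDr sumr_ge0// => i _; rewrite sqr_ge0.
Qed.

Lemma l2_complete (F : set_system l2) : ProperFilter F -> cauchy F -> cvg F.
Proof.
move=> FF cF.
have coord_cvg k : cvg ((fun f : l2 => f k) @ F).
  apply: cauchy_cvg; apply/cauchy_ballP => e e0.
  move/cauchy_ballP : cF => /(_ e e0) [[A B] /= [FA FB] AB].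
  exists ([set f k | f in A], [set f k | f in B]).
    by split; [apply: filterS FA|apply: filterS FB] => f Hf; exists f.
  move=> [_ _] [/= [f Af <-] [g Bg <-]].
  have := AB (f, g) (conj Af Bg); rewrite -!ball_normE/=; apply: le_lt_trans.
  exact: (l2_coord_le (f - g)).
pose g : nat -> H := fun k => lim ((fun f : l2 => f k) @ F).
have key (e : R) (A : set l2) (a : l2) : 0 < e -> F A ->
    (forall f, A f -> `|f - a| <= e) ->
    forall n, \sum_(0 <= k < n) `|g k - a k| ^+ 2 <= e ^+ 2.
  move=> e0 FA Aa n.
  have cv : (fun f : l2 => \sum_(0 <= k < n) `|f k - a k| ^+ 2) @ F -->
            \sum_(0 <= k < n) `|g k - a k| ^+ 2.
    elim: n => [|n IHn].
      by rewrite big_nil; under eq_fun do rewrite big_nil; exact: cvg_cst.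
    rewrite big_nat_recr//=; under eq_fun do rewrite big_nat_recr//=.
    apply: cvgD IHn _; rewrite expr2; under eq_fun do rewrite expr2.
    have nk : (fun f : l2 => `|f n - a n|) @ F --> `|g n - a n|.
      by apply: cvg_norm; apply: cvgB; [exact: coord_cvg|exact: cvg_cst].
    exact: cvgM.
  rewrite -(cvg_lim _ cv)//; apply: limr_le; first exact: cvgP cv.
  apply: filterS FA => f /Aa fa; apply: le_trans (l2_sum_le (f - a) n) _.
  by rewrite lerXn2r ?nnegrE ?(ltW e0).
have near_a (e : R) : 0 < e -> exists A a, [/\ F A, A a & forall f, A f -> `|f - a| <= e].
  move=> e0; move/cauchy_ballP : cF => /(_ e e0) [[A B] /= [FA FB] AB].
  have [a [Aa Ba]] := filter_ex (filterI FA FB).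
  exists (A `&` B), a; split => //; first exact: filterI.
  by move=> f [Af _]; have := AB (f, a) (conj Af Ba); rewrite -ball_normE/= => /ltW.
have g2 : g \in square_summable.
  have [A [a [FA Aa Ae]]] := near_a 1 ltr01.
  have ga : (fun k => g k - a k) \in square_summable := l2_bound (key _ _ _ ltr01 FA Ae).
  rewrite (_ : g = (fun k => g k - a k) + (a : nat -> H)).
    by apply: rpredD => //; exact: l2valP.
  by apply/funext => k /=; rewrite [RHS]subrK.
apply/cvg_ex; exists (L2 g2); apply/cvgrPdist_le => /= e e0.
have e20 : 0 < e / 2 by rewrite divr_gt0.
have [A [a [FA Aa Ae]]] := near_a _ e20.
apply: (filterS _ FA) => f Af; rewrite (splitr e) -(subrKA a).
apply: le_trans (ler_normD _ _) _; apply: lerD; last first.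
  by rewrite distrC; exact: Ae.
by apply: l2norm_le => [|n]; [exact: ltW | exact: (key _ _ _ e20 FA Ae)].
Qed.

HB.instance Definition _ := Uniform_isComplete.Build l2 l2_complete.

HB.instance Definition _ := isHilbert.Build R l2
  (fun f g => ip_sym l2dot_inner I I)
  (fun a f g h => ip_lin l2dot_inner a I I I) l2norm_sqr.

End L2.

Section Operators.
Context {R : realType} {H : hilbertType R}.
Implicit Types (f g : l2 H) (x y : l2 R^o) (B : l2 R^o -> l2 R^o).

Lemma bullet_subproof (h : H) x : (fun k => (x k : R) *: h) \in @square_summable R H.
Proof.
apply/asboolP; rewrite (_ : (fun k => _) = `|h| ^+ 2 *: (fun k => `|x k| ^+ 2)).
  by apply: is_cvg_seriesZ; exact: l2_cvg.
by apply/funext => k; rewrite normrZ exprMn mulrC.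
Qed.

Definition bullet (h : H) x : l2 H := L2 (bullet_subproof h x).

Definition bracket f x : H := limn (series (fun k => (x k : R) *: f k)).

(* The operator on l2 H induced by B, computed in the orthonormal basis b; for
   bounded B it does not depend on b. *)
Definition induced_op (b : nat -> l2 R^o) B f : l2 H :=
  limn (series (fun k => bullet (bracket f (b k)) (B (b k)))).

End Operators.

Section FormA.
Context {R : realType} {V : hilbertType R}.
Implicit Types A : V -> V.

Definition bounded_operator A := exists M : R, forall x, `|A x| <= M * `|x|.
Definition self_adjoint A := forall x y, dot (A x) y = dot x (A y).
Definition positive_definite A := forall x, x <> 0 -> 0 < dot x (A x).

Definition dotA A (x y : V) : R := dot x (A y).
Definition normA A (x : V) : R := Num.sqrt (dotA A x x).

Definition in_span (n : nat) (x : 'I_n -> V) (y : V) :=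
  exists c : 'I_n -> R, y = \sum_(k < n) c k *: x k.

Definition orthonormal_for A (n : nat) (x : 'I_n -> V) :=
  forall i j, dotA A (x i) (x j) = (i == j)%:R.

Definition orthogonal_projection_for A (n : nat) (x : 'I_n -> V) (P : V -> V) :=
  forall y, in_span x (P y) /\ forall z, in_span x z -> dotA A (y - P y) z = 0.

End FormA.

(* Everything is realised inside H: the completion [gt_Np p] of [gt_N] for the
   p-th norm is the subspace of H obtained by extending the inclusion N -> H
   continuously (injective by compatibility), with extended inner product
   [gt_ip p]. Values of [gt_ip p] outside [gt_Np p] are irrelevant. *)
Record gelfand_triple {R : realType} (H : hilbertType R) := GelfandTriple {
  gt_N : set H ;
  gt_Np : nat -> set H ;
  gt_ip : nat -> H -> H -> R ;
  gt_N_sub : linear_subspace gt_N ;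
  gt_Np_sub : forall p, linear_subspace (gt_Np p) ;
  gt_Np_ip : forall p, inner_product_on (gt_Np p) (gt_ip p) ;
  gt_N_Np : forall p, gt_N `<=` gt_Np p ;
  gt_Np_complete : forall p, ip_complete (gt_Np p) (gt_ip p) ;
  gt_N_dense : forall p x (eps : R), gt_Np p x -> 0 < eps ->
    exists2 y, gt_N y & ipnorm (gt_ip p) (x - y) < eps ;
  gt_N0 : gt_Np 0%N = setT ;
  gt_ip0 : forall x y, gt_ip 0%N x y = dot x y ;
  gt_incl : forall p, gt_Np p.+1 `<=` gt_Np p ;
  gt_incr : forall p x, gt_Np p.+1 x ->
    ipnorm (gt_ip p) x <= ipnorm (gt_ip p.+1) x ;
  gt_compat : forall p q (u : nat -> H), (forall n, gt_N (u n)) ->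
    ip_cvg (gt_ip p) u 0 -> ip_cauchy (gt_ip q) u -> ip_cvg (gt_ip q) u 0 ;
  gt_N_complete : forall u : nat -> H, (forall n, gt_N (u n)) ->
    (forall p, ip_cauchy (gt_ip p) u) ->
    exists2 x, gt_N x & forall p, ip_cvg (gt_ip p) u x ;
  (* The inclusion of gt_Np p.+1 into gt_Np p is Hilbert-Schmidt. *)
  gt_HS : forall p, exists2 e : nat -> H,
    orthonormal_basis_of (gt_Np p.+1) (gt_ip p.+1) e &
    cvgn (series (fun k => ipnorm (gt_ip p) (e k) ^+ 2))
}.

Section SN.
Context {R : realType} {H : hilbertType R} (G : gelfand_triple H).

(* Sequences are indexed from 0 here, whence the weight k.+1. *)
Definition weighted_sq (p : nat) (f : nat -> H) (k : nat) : R :=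
  k.+1%:R ^+ (2 * p) * ipnorm (gt_ip G p) (f k) ^+ 2.

Definition l2p (p : nat) : set (nat -> H) :=
  [set f | (forall k, gt_Np G p (f k)) /\ cvgn (series (weighted_sq p f))].

Definition l2p_norm (p : nat) (f : nat -> H) : R :=
  Num.sqrt (limn (series (weighted_sq p f))).

Definition s_pred : {pred nat -> H} :=
  fun f => `[< (\bigcap_p l2p p) f >].

Lemma ip_norm2_le p (a : R) x y : gt_Np G p x -> gt_Np G p y ->
  ipnorm (gt_ip G p) (a *: x + y) ^+ 2 <=
  2 * a ^+ 2 * ipnorm (gt_ip G p) x ^+ 2 + 2 * ipnorm (gt_ip G p) y ^+ 2.
Proof.
have [N0 NP] := gt_Np_sub G p; move: (gt_ip G p) (gt_Np_ip G p) => ip iN.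
have ip0l z : gt_Np G p z -> ip 0 z = 0.
  move=> Nz; have := ip_lin iN (-1) N0 N0 Nz.
  by rewrite scaler0 addr0 mulN1r addNr.
have ge0 z : gt_Np G p z -> 0 <= ip z z.
  move=> Nz; have [->|/eqP z0] := eqVneq z 0; first by rewrite ip0l.
  exact/ltW/(ip_pos iN).
have ex u v c : gt_Np G p u -> gt_Np G p v -> gt_Np G p (c *: u + v) ->
    ip (c *: u + v) (c *: u + v) = c ^+ 2 * ip u u + 2 * c * ip u v + ip v v.
  move=> Nu Nv Nw; rewrite (ip_lin iN)// (ip_sym iN Nu Nw) (ip_sym iN Nv Nw).
  by rewrite !(ip_lin iN)// (ip_sym iN Nv Nu); ring.
move=> Nx Ny; rewrite /ipnorm.
have Nw1 := NP a _ _ Nx Ny; have Nw2 := NP (- a) _ _ Nx Ny.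
rewrite !sqr_sqrtr ?ge0//; have := ge0 _ Nw2; rewrite !ex//; lra.
Qed.

Lemma s_submod : submod_closed s_pred.
Proof.
split=> [|a f g /asboolP sf /asboolP sg]; apply/asboolP => p _.
  have [N0 NP] := gt_Np_sub G p; split => //.
  have ip00 : ipnorm (gt_ip G p) 0 = 0.
    have := ip_lin (gt_Np_ip G p) (-1) N0 N0 N0.
    by rewrite scaler0 addr0 mulN1r addNr /ipnorm => ->; rewrite sqrtr0.
  rewrite (_ : series _ = cst 0); first exact: is_cvg_cst.
  by apply/funext => n; rewrite /series/= big1// => k _;
    rewrite /weighted_sq [(0 : nat -> H) k]/(0 : H) ip00 expr0n mulr0.
have [fN cf] := sf p I; have [gN cg] := sg p I; have [N0 NP] := gt_Np_sub G p.
split=> [k|]; first exact: NP.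
have cfg : cvgn (series ((2 * a ^+ 2) *: weighted_sq p f + 2 *: weighted_sq p g)).
  by apply: is_cvg_seriesD; apply: is_cvg_seriesZ.
have w0 q k : 0 <= weighted_sq q (a *: f + g) k.
  by apply: mulr_ge0; rewrite exprn_ge0// sqrtr_ge0.
have le k : weighted_sq p (a *: f + g) k <=
    ((2 * a ^+ 2) *: weighted_sq p f + 2 *: weighted_sq p g) k.
  have := ip_norm2_le a (fN k) (gN k).
  rewrite -(ler_pM2l (exprn_gt0 (2 * p) (ltr0Sn R k))) => /le_trans; apply.
  rewrite le_eqVlt; apply/orP; left; apply/eqP.
  transitivity ((2 * a ^+ 2) * weighted_sq p f k + 2 * weighted_sq p g k) => //.
  by rewrite /weighted_sq; move: (k.+1%:R ^+ (2 * p)) => c; ring.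
by apply: series_le_cvg cfg => // k; exact: le_trans (w0 p k) (le k).
Qed.

HB.instance Definition _ := GRing.isSubmodClosed.Build R (nat -> H) s_pred s_submod.

Record sN := SN { sN_val :> nat -> H ; sN_valP : sN_val \in s_pred }.

HB.instance Definition _ := [isSub for sN_val].
HB.instance Definition _ := [Choice of sN by <:].
HB.instance Definition _ := [SubChoice_isSubLmodule of sN by <:].

Definition s_open : set_system sN := [set U | forall phi, U phi ->
  exists (p : nat) (e : R), 0 < e /\
    forall psi : sN, (forall q, (q <= p)%N -> l2p_norm q (psi - phi) < e) -> U psi].

Lemma s_openT : s_open setT. Proof. by move=> phi _; exists 0%N, 1. Qed.

Lemma s_openI : setI_closed s_open.
Proof.
move=> U V oU oV phi [/oU[p [e [e0 Ue]]] /oV[q [d [d0 Vd]]]].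
exists (maxn p q), (Num.min e d); split; first by rewrite lt_min e0 d0.
move=> psi h; split.
  apply: Ue => r rp; have := h r (leq_trans rp (leq_maxl _ _)).
  by rewrite lt_min => /andP[].
apply: Vd => r rq; have := h r (leq_trans rq (leq_maxr _ _)).
by rewrite lt_min => /andP[].
Qed.

Lemma s_open_bigU (I : Type) (U : I -> set sN) :
  (forall i, s_open (U i)) -> s_open (\bigcup_i U i).
Proof.
move=> oU phi [i _ /(oU i)[p [e [e0 Ue]]]].
by exists p, e; split=> // psi /Ue; exists i.
Qed.

HB.instance Definition _ := isOpenTopological.Build sN s_openT s_openI s_open_bigU.

Lemma sN_square_summable (phi : sN) : sN_val phi \in @square_summable R H.
Proof.
have /asboolP/(_ 0%N I)[_ c0] := sN_valP phi; apply/asboolP.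
rewrite (_ : (fun k => _) = weighted_sq 0 phi)//; apply/funext => k.
by rewrite /weighted_sq muln0 expr0 mul1r /ipnorm gt_ip0 dot_norm sqr_sqrtr ?sqr_ge0.
Qed.

Definition sN_l2 (phi : sN) : l2 H := L2 (sN_square_summable phi).

(* The topological dual s'(N). *)
Record sN_dual := SNDual {
  sN_dual_val :> {linear sN -> R^o} ;
  sN_dual_cont : continuous (sN_dual_val : sN -> R^o)
}.

HB.instance Definition _ := gen_eqMixin sN_dual.
HB.instance Definition _ := gen_choiceMixin sN_dual.

Lemma sN_dual0_cont : continuous (\0 : sN -> R^o).
Proof. exact: cst_continuous. Qed.

HB.instance Definition _ := isPointed.Build sN_dual
  (@SNDual (\0 : {linear sN -> R^o}) sN_dual0_cont).

Definition cylinder_sets : set (set sN_dual) :=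
  [set (fun w : sN_dual => (w phi : R)) @^-1` B | phi in [set: sN] & B in measurable].

Definition sN_dualM := g_sigma_algebraType cylinder_sets.

End SN.

Section CondExp.
Context d (T : measurableType d) {R : realType} (mu : probability T R).

Definition is_cond_exp (S : set (set T)) (F E : T -> R) :=
  [/\ forall B : set R, measurable B -> S (E @^-1` B),
      mu.-integrable setT (EFin \o E) &
      forall D, S D ->
        (\int[mu]_(w in D) (E w)%:E = \int[mu]_(w in D) (F w)%:E)%E].

Definition cond_exp (S : set (set T)) (F : T -> R) : T -> R :=
  xget (cst 0) [set E | is_cond_exp S F E].

End CondExp.

Section MuA.
Context {R : realType} {H : hilbertType R} {G : gelfand_triple H}.
Variable mu : probability (sN_dualM G) R.
Implicit Types A : l2 H -> l2 H.

Definition dual_pairing (phi : sN G) (w : sN_dualM G) : R := (w : sN_dual G) phi.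

(* Real and imaginary part of
   \int exp(i <phi, w>) dmu = exp(- (phi, phi)_A / 2). *)
Definition has_gaussian_char_fun A := forall phi : sN G,
  (\int[mu]_w (cos (dual_pairing phi w))%:E =
     (expR (- (dotA A (sN_l2 phi) (sN_l2 phi)) / 2))%:E)%E /\
  (\int[mu]_w (sin (dual_pairing phi w))%:E = 0)%E.

Definition is_pairing A (f : l2 H) (X : sN_dualM G -> R) :=
  X \in Lfun mu 2%:E /\
  exists phi : nat -> sN G,
    (normA A (sN_l2 (phi k) - f) @[k --> \oo] --> (0 : R)) /\
    (Lnorm mu 2%:E (EFin \o (dual_pairing (phi k) \- X)) @[k --> \oo] --> 0%E).

(* A representative of <f, .> in L^2(mu). *)
Definition pairing A (f : l2 H) : sN_dualM G -> R :=
  xget (cst 0) [set X | is_pairing A f X].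

Definition direction_sigma A (h : nat -> H) (n : nat) (x : 'I_n -> l2 R^o) :
    set (set (sN_dualM G)) :=
  <<s [set S | exists (i : nat) (k : 'I_n), exists2 B : set R, measurable B &
         S = pairing A (bullet (h i) (x k)) @^-1` B] >>.

Definition direction_cond_exp A (h : nat -> H) (n : nat) (x : 'I_n -> l2 R^o)
    (F : sN_dualM G -> R) : sN_dualM G -> R :=
  cond_exp mu (direction_sigma A h x) F.

End MuA.

(* Main.v *)
(* By the Fourier characterisation of [mu], the variables <f, .> form a centred
   Gaussian field, linear in [f], with covariance (., .)_A. Put
   p := sum_k [f, A x_k] . x_k. The residual f - p is orthogonal for (., .)_A to
   every h_i . x_k, because pairing with h_i reduces this to the orthonormality
   of the x_k in l2(R); hence <f - p, .> is independent of the conditioning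
   sigma-algebra. Since <p, .> is an L2-limit of finite combinations of the
   <h_i . x_k, .>, it has a version measurable for that sigma-algebra, and is
   therefore the conditional expectation. Finally p = P f, since both have the
   same component along every u in H.

   Independence is only used in the form \int_D <f - p, .> = 0. It is obtained
   without uniqueness theorems for Fourier transforms: polynomials in
   sin ((X - a) / n) converge boundedly to the indicator of the ray {a < X},
   and products of trigonometric functions linearise, so that a monotone class
   argument applies. *)
Require Import Defs.
From mathcomp Require Import all_boot all_order all_algebra.
From mathcomp Require Import all_classical all_reals all_analysis.
From mathcomp Require Import measurable_realfun ring lra.

Set Implicit Arguments.
Unset Strict Implicit.
Unset Printing Implicit Defensive.
Import Order.TTheory GRing.Theory Num.Theory.
Import numFieldNormedType.Exports.
Local Open Scope classical_set_scope.
Local Open Scope ring_scope.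

(** The measure is known only through integrals of cosines and sines, so no moment, not even
    integrability, is available beforehand. An unbounded factor $X$ is therefore handled as the
    limit of $n\sin(X/n)$, which $|X|$ dominates once $X$ is known to be integrable; that in turn
    follows from a bound on the second moment. A polynomial in a sine is periodic and cannot isolate
    a ray at a fixed scale, which is why one limit is taken in the degree and another in the scale.
    A second obstacle is that [pairing] chooses a representative for each vector separately:
    linearity holds only almost everywhere, with an exceptional set that depends on the vectors. The
    Gaussian part is therefore written for an abstract family that is linear in this weak sense, and
    the conditional expectation is identified through a measurable version, not through [pairing]
    itself. *)

(** * Polynomial approximation of the unit step *)

Section StepApproximation.
Context {R : realType}.
Implicit Types s : R.

(* The smoothstep polynomial maps [-1, 1] to itself, and its iterates push
   every nonzero point towards its sign. *)
Fixpoint smoothstep (n : nat) : {poly R} :=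
  if n is m.+1 then (3 / 2) *: smoothstep m - (1 / 2) *: smoothstep m ^+ 3
  else 'X.

Lemma smoothstepS n s : (smoothstep n.+1).[s] =
  3 / 2 * (smoothstep n).[s] - 1 / 2 * (smoothstep n).[s] ^+ 3.
Proof. by rewrite /= hornerD hornerN !hornerZ horner_exp. Qed.

Lemma smoothstepN n s : (smoothstep n).[- s] = - (smoothstep n).[s].
Proof.
elim: n => [|n IHn]; first by rewrite /= !hornerX.
by rewrite !smoothstepS IHn; ring.
Qed.

(** With $S(u)=(3u-u^3)/2$ one has $1-S(u)=(1-u)(1-(u+u^2)/2)$, so the distance to the fixed point 1
    shrinks at least by the factor $1-u/2$. The lower bound $s\le u$ is carried along to make this
    factor uniform. *)
Lemma smoothstep_bounds n s : 0 < s -> s <= 1 ->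
  s <= (smoothstep n).[s] <= 1 /\
  1 - (smoothstep n).[s] <= (1 - s / 2) ^+ n.
Proof.
move=> s0 s1; elim: n => [|n [/andP[su u1] IHn]].
  by rewrite /= hornerX expr0 lexx s1; split=> //; lra.
rewrite smoothstepS [_ ^+ n.+1]exprS.
move: (_.[s]) su u1 IHn => u su u1 IHn.
have k0 : 0 <= 1 - s / 2 by lra.
have key : 1 - (3 / 2 * u - 1 / 2 * u ^+ 3) <= (1 - s / 2) * (1 - u).
  rewrite -subr_ge0.
  have -> : (1 - s / 2) * (1 - u) - (1 - (3 / 2 * u - 1 / 2 * u ^+ 3)) =
    (1 - u) * (u ^+ 2 + (u - s)) / 2 by field.
  by rewrite divr_ge0// mulr_ge0 ?subr_ge0// addr_ge0 ?sqr_ge0 ?subr_ge0.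
split; first last.
  by apply: (le_trans key); exact: ler_wpM2l.
have u0 : 0 <= u by lra.
apply/andP; split.
  rewrite (le_trans su)// -subr_ge0.
  have -> : 3 / 2 * u - 1 / 2 * u ^+ 3 - u = u * (1 - u) * (1 + u) / 2 by field.
  by rewrite divr_ge0// !mulr_ge0 ?subr_ge0 ?addr_ge0.
rewrite -subr_ge0.
have -> : 1 - (3 / 2 * u - 1 / 2 * u ^+ 3) = (1 - u) ^+ 2 * (2 + u) / 2 by field.
by rewrite divr_ge0// mulr_ge0 ?sqr_ge0 ?addr_ge0.
Qed.

Lemma smoothstep_cvg1 s : 0 < s -> s <= 1 ->
  (smoothstep n).[s] @[n --> \oo] --> (1 : R).
Proof.
move=> s0 s1; have k1 : `|1 - s / 2| < 1 by rewrite ger0_norm; lra.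
apply: (@squeeze_cvgr _ _ _ _ (fun n => 1 - (1 - s / 2) ^+ n) (cst 1)).
- apply: nearW => n; have [/andP[_ u1] h] := smoothstep_bounds n s0 s1.
  by rewrite u1 andbT lerBlDr addrC -lerBlDr.
- rewrite -[X in _ --> X]subr0; apply: cvgB; first exact: cvg_cst.
  exact: cvg_expr.
- exact: cvg_cst.
Qed.

Lemma smoothstep0 n : (smoothstep n).[0] = 0.
Proof.
elim: n => [|n IHn]; first by rewrite /= hornerX.
by rewrite smoothstepS IHn; ring.
Qed.

Lemma smoothstep_norm n s : `|s| <= 1 -> `|(smoothstep n).[s]| <= 1.
Proof.
have pos t : 0 < t -> t <= 1 -> `|(smoothstep n).[t]| <= 1.
  move=> t0 t1; have [/andP[tu u1] _] := smoothstep_bounds n t0 t1.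
  by rewrite ger0_norm//; lra.
have [s0|s0|->] := ltgtP s 0; last by rewrite smoothstep0 normr0 ler01.
- rewrite ltr0_norm// => s1; rewrite -[s]opprK smoothstepN normrN.
  by apply: pos => //; lra.
- by rewrite gtr0_norm// => s1; exact: pos.
Qed.

Lemma step_approx : exists q : nat -> {poly R}, forall s, `|s| <= 1 ->
  (forall n, `|(q n).[s]| <= 1) /\
  (q n).[s] @[n --> \oo] --> ((0 < s)%R%:R : R).
Proof.
(* $(u+u^2)/2$ sends the three limits $-1,0,1$ to $0,0,1$; the value at the origin matches the
   strict inequality [0 < s]. *)
exists (fun n => (1 / 2) *: (smoothstep n + smoothstep n ^+ 2)) => s s1.
have qE n : ((1 / 2) *: (smoothstep n + smoothstep n ^+ 2)).[s] =
   1 / 2 * ((smoothstep n).[s] + (smoothstep n).[s] * (smoothstep n).[s]).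
  by rewrite hornerZ hornerD horner_exp expr2.
have [s0|s0|->] := ltgtP s 0.
- have sN : (smoothstep n).[s] @[n --> \oo] --> (-1 : R).
    rewrite -[s]opprK; under eq_fun do rewrite smoothstepN.
    by apply: cvgN; apply: smoothstep_cvg1; move: s1; rewrite ?ltr0_norm//; lra.
  split.
    move=> n; have := smoothstep_norm n s1; rewrite qE.
    by rewrite !ler_norml => /andP[? ?]; apply/andP; split; nra.
  under eq_fun do rewrite qE.
  rewrite (_ : false%:R = 1 / 2 * (-1 + -1 * -1) :> R); last by rewrite /=; field.
  by apply: cvgM; [exact: cvg_cst|apply: cvgD => //; exact: cvgM].
- have sN : (smoothstep n).[s] @[n --> \oo] --> (1 : R).
    by apply: smoothstep_cvg1 => //; move: s1; rewrite gtr0_norm.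
  split.
    move=> n; have := smoothstep_norm n s1; rewrite qE.
    by rewrite !ler_norml => /andP[? ?]; apply/andP; split; nra.
  under eq_fun do rewrite qE.
  rewrite (_ : true%:R = 1 / 2 * (1 + 1 * 1) :> R); last by rewrite /=; field.
  by apply: cvgM; [exact: cvg_cst|apply: cvgD => //; exact: cvgM].
- have q0 n : ((1 / 2) *: (smoothstep n + smoothstep n ^+ 2)).[0] = 0 :> R.
    by rewrite hornerZ hornerD horner_exp smoothstep0; ring.
  split; first by move=> n; rewrite q0 normr0 ler01.
  by under eq_fun do rewrite q0; exact: cvg_cst.
Qed.

(** Once $|y|<(n+1)\pi$ the sine has the sign of $y$: growing scales undo the periodicity, and the
    sequence is eventually constant. *)
Lemma sin_scale_step (y : R) :
  ((0 < sin (y / n.+1%:R))%R%:R : R) @[n --> \oo] --> ((0 < y)%R%:R : R).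
Proof.
apply: cvg_near_cst.
have pos (z : R) : 0 < z -> \forall n \near \oo, 0 < sin (z / n.+1%:R).
  move=> z0; near=> n; apply: sin_gt0_pi; rewrite divr_gt0//=.
  rewrite ltr_pdivrMr// mulrC -ltr_pdivrMr ?pi_gt0//.
  apply: (@lt_le_trans _ _ n%:R); last by rewrite ler_nat.
  by near: n; exact: nbhs_infty_gtr.
have [y0|y0|->] := ltgtP y 0.
- have := pos (- y); rewrite oppr_gt0 => /(_ y0); apply: filterS => n.
  by rewrite mulNr sinN oppr_gt0 => h; rewrite ltNge (ltW h).
- by have := pos _ y0; apply: filterS => n ->.
- by apply: nearW => n; rewrite mul0r sin0 ltxx.
Unshelve. all: by end_near. Qed.

End StepApproximation.

(** * Vanishing Fourier integrals for one real variable *)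

Section Expectation.
Context d (T : measurableType d) {R : realType} (mu : probability T R).
Implicit Types (f g X Y Z : T -> R).

Local Notation integrable f := (mu.-integrable setT (EFin \o f)).

Lemma integrable_measurable f : integrable f -> measurable_fun setT f.
Proof. by move=> /integrableP[/measurable_EFinP]. Qed.

Lemma le_integrableR f g : measurable_fun setT f ->
  (forall w, `|f w| <= `|g w|) -> integrable g -> integrable f.
Proof.
move=> mf fg; apply: le_integrable => //; first exact/measurable_EFinP.
by move=> w _; rewrite /= lee_fin.
Qed.

Lemma integrableDR f g : integrable f -> integrable g ->
  integrable (fun w => f w + g w).
Proof. by move=> fi gi; exact: (integrableD measurableT fi gi). Qed.

Lemma integrableZR f (c : R) : integrable f -> integrable (fun w => c * f w).
Proof. by move=> fi; exact: (integrableZl measurableT c fi). Qed.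

Lemma integrableM_bounded f g (M : R) : integrable f -> measurable_fun setT g ->
  (forall w, `|g w| <= M) -> integrable (fun w => f w * g w).
Proof.
move=> fi mg gM; have fM : integrable (fun w => M * f w).
  exact: (integrableZl measurableT M fi).
apply: le_integrableR fM.
  by apply: measurable_funM => //; exact: integrable_measurable.
move=> w; rewrite !normrM mulrC ler_wpM2r//.
by rewrite (le_trans (gM w))// ler_norm.
Qed.

Lemma integrable_bounded f (M : R) : measurable_fun setT f ->
  (forall w, `|f w| <= M) -> integrable f.
Proof.
move=> mf fM.
have c1 : integrable (cst 1).
  by apply: finite_measure_integrable_cst.
have := integrableM_bounded c1 mf fM; apply: eq_integrable => // w _ /=.
by rewrite mul1r.
Qed.

Lemma Rintegral_cvg (F : nat -> T -> R) f g :
  (forall n, measurable_fun setT (F n)) -> (forall w, F n w @[n --> \oo] --> f w) ->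
  integrable g -> (forall n w, `|F n w| <= g w) ->
  (\int[mu]_w F n w)%R @[n --> \oo] --> (\int[mu]_w f w)%R.
Proof.
move=> mF Ff gi Fg.
have mf : measurable_fun setT f by apply: measurable_fun_cvg mF _ => w _.
have [fi _ cv] : [/\ mu.-integrable setT (EFin \o f),
    [sequence (\int[mu]_(w in setT) `|(F n w)%:E - (f w)%:E|)%E]_n @ \oo --> 0%E &
    [sequence (\int[mu]_(w in setT) (F n w)%:E)%E]_n @ \oo
       --> (\int[mu]_(w in setT) (f w)%:E)%E].
  apply: (@dominated_convergence _ _ _ mu setT measurableT
            (fun n w => (F n w)%:E) (EFin \o f) (EFin \o g)) => //.
  - by move=> n; exact/measurable_EFinP.
  - exact/measurable_EFinP.
  - by apply: aeW => w _; apply: cvg_EFin; [exact: nearW|exact: Ff].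
  - by apply: aeW => w n _; rewrite /= lee_fin.
have ff : (\int[mu]_(w in setT) (f w)%:E)%E \is a fin_num.
  exact: integrable_fin_num.
by apply: fine_cvg; rewrite /Rintegral fineK.
Qed.

Lemma measurable_cos_affine X (t c : R) : measurable_fun setT X ->
  measurable_fun setT (fun w => cos (t * X w + c)).
Proof.
move=> mX; apply: (measurableT_comp (f := @cos R)).
  by apply: continuous_measurable_fun; exact: continuous_cos.
apply: measurable_funD => //; apply: measurable_funM => //.
Qed.

(** Sines become cosines with a phase, so that a single family $\cos(tX+c)$ of test functions
    suffices, and products of its members are linear combinations of members. *)
Lemma sinE_cos (u : R) : sin u = cos (u - pi / 2).
Proof. by rewrite cosB cos_pihalf sin_pihalf mulr0 add0r mulr1. Qed.

Lemma sinMcos (u v : R) :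
  sin u * cos v = 1 / 2 * (cos (u + v - pi / 2) + cos (u - v - pi / 2)).
Proof. by rewrite -!sinE_cos sinD sinB; field. Qed.

Lemma cosMcos (u v : R) : cos u * cos v = 1 / 2 * (cos (u + v) + cos (u - v)).
Proof. by rewrite cosD cosB; field. Qed.

Lemma Rintegral_halfD f g : integrable f -> integrable g ->
  (\int[mu]_w f w = 0)%R -> (\int[mu]_w g w = 0)%R ->
  (\int[mu]_w (1 / 2 * (f w + g w)) = 0)%R.
Proof.
move=> fi gi f0 g0; rewrite RintegralZl//; last exact: integrableDR.
by rewrite RintegralD// f0 g0 addr0 mulr0.
Qed.

Section OneVariable.
Variables Z X : T -> R.
Hypothesis Zi : integrable Z.
Hypothesis mX : measurable_fun setT X.
Hypothesis ZX : forall t c : R, (\int[mu]_w (Z w * cos (t * X w + c)) = 0)%R.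

Let polyP (p : {poly R}) (s e : R) :
  measurable_fun setT (fun w => p.[sin (s * X w + e)]).
Proof.
apply: (measurableT_comp (f := fun y => p.[y])).
  by apply: continuous_measurable_fun => y; exact: continuous_horner.
under eq_fun do rewrite sinE_cos -addrA.
exact: measurable_cos_affine.
Qed.

Let poly_bound (p : {poly R}) : exists M : R, forall y, `|y| <= 1 -> `|p.[y]| <= M.
Proof.
elim/poly_ind: p => [|p c [M pM]].
  by exists 0 => y _; rewrite horner0 normr0.
exists (M + `|c|) => y y1; rewrite hornerMXaddC.
rewrite (le_trans (ler_normD _ _))// lerD2r normrM.
have M0 : 0 <= M by apply: le_trans (pM 0 _); rewrite ?normr0.
by rewrite -[leRHS]mulr1 ler_pM// pM.
Qed.

Let intP (p : {poly R}) (s e t c : R) :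
  integrable (fun w => Z w * p.[sin (s * X w + e)] * cos (t * X w + c)).
Proof.
apply: (@integrableM_bounded _ _ 1); last by move=> w; exact: cos_max.
  have [M pM] := poly_bound p; apply: (@integrableM_bounded _ _ M) => // w.
  exact/pM/sin_max.
exact: measurable_cos_affine.
Qed.

Let int_poly (p : {poly R}) (s e t c : R) :
  (\int[mu]_w (Z w * p.[sin (s * X w + e)] * cos (t * X w + c)) = 0)%R.
Proof.
(* [t] and [c] are generalised because each Horner step multiplies by a sine, which [sinMcos]
   absorbs into two cosines with new frequency and phase. *)
elim/poly_ind: p t c => [|p c' IHp] t c.
  under eq_Rintegral do rewrite horner0 mulr0 mul0r.
  by rewrite Rintegral_cst// mul0r.
transitivity (\int[mu]_w
    (1 / 2 * (Z w * p.[sin (s * X w + e)] * cos ((s + t) * X w + (e + c - pi / 2))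
            + Z w * p.[sin (s * X w + e)] * cos ((s - t) * X w + (e - c - pi / 2)))
     + c' * (Z w * cos (t * X w + c))))%R.
  apply: eq_Rintegral => w _; rewrite hornerMXaddC.
  have := sinMcos (s * X w + e) (t * X w + c).
  rewrite (_ : s * X w + e + (t * X w + c) - pi / 2 =
    (s + t) * X w + (e + c - pi / 2)); last by ring.
  rewrite (_ : s * X w + e - (t * X w + c) - pi / 2 =
    (s - t) * X w + (e - c - pi / 2)); last by ring.
  move=> sc.
  rewrite (_ : Z w * (_ + c') * _ = Z w * p.[sin (s * X w + e)] *
    (sin (s * X w + e) * cos (t * X w + c)) + c' * (Z w * cos (t * X w + c)));
    last by ring.
  by rewrite sc; ring.
have Zc : integrable (fun w => Z w * cos (t * X w + c)).
  apply: (@integrableM_bounded _ _ 1) => //; last by move=> w; exact: cos_max.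
  exact: measurable_cos_affine.
rewrite RintegralD//.
- rewrite Rintegral_halfD// ?add0r; try exact: IHp; try exact: intP.
  by rewrite RintegralZl// ZX mulr0.
- by apply: integrableZR; apply: integrableDR; exact: intP.
- exact: integrableZR.
Qed.

(** Two limits dominated by $|Z|$: at a fixed scale the polynomials [q k] of the sine tend to the
    indicator of a positive sine, and then the scale tends to infinity. *)
Lemma Rintegral_ray_eq0 (a : R) : (\int[mu]_w (Z w * (a < X w)%R%:R) = 0)%R.
Proof.
have [q qP] := @step_approx R.
have normZ : integrable (fun w => `|Z w|) by exact: integrable_norm.
have step n : (\int[mu]_w (Z w * (0 < sin ((X w - a) / n.+1%:R))%R%:R) = 0)%R.
  have qX k : (\int[mu]_w (Z w * (q k).[sin ((X w - a) / n.+1%:R)]) = 0)%R.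
    rewrite -[RHS](int_poly (q k) (n.+1%:R^-1) (- (a / n.+1%:R)) 0 0).
    apply: eq_Rintegral => w _; rewrite mul0r add0r cos0 mulr1.
    by congr (_ * (_.[sin _])); rewrite mulrBl mulrC.
  rewrite -[RHS](_ : limn (fun k => \int[mu]_w (Z w * (q k).[sin ((X w - a) / n.+1%:R)]))%R = 0).
    apply/esym/cvg_lim => //; apply: Rintegral_cvg normZ _ => [k|w|k w].
    - apply: measurable_funM; first exact: integrable_measurable.
      rewrite (_ : (fun w => _) = (fun w => (q k).[sin (n.+1%:R^-1 * X w + - (a / n.+1%:R))])).
        exact: polyP.
      by apply/funext => w; rewrite mulrBl [_ * X w]mulrC.
    - apply: cvgM; first exact: cvg_cst.
      by have [] := qP _ (sin_max ((X w - a) / n.+1%:R)).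
    - rewrite normrM ler_piMr//.
      by have [] := qP _ (sin_max ((X w - a) / n.+1%:R)).
  by under eq_fun do rewrite qX; exact: lim_cst.
rewrite -[RHS](_ : limn (fun n => \int[mu]_w (Z w * (0 < sin ((X w - a) / n.+1%:R))%R%:R))%R = 0).
  apply/esym/cvg_lim => //; apply: Rintegral_cvg normZ _ => [n|w|n w].
  - apply: measurable_funM; first exact: integrable_measurable.
    apply: (measurableT_comp (f := fun b : bool => (b%:R : R))) => //.
    apply: measurable_fun_ltr => //.
    rewrite (_ : (fun w => _) = (fun w => 'X.[sin (n.+1%:R^-1 * X w + - (a / n.+1%:R))])).
      exact: polyP.
    by apply/funext => w; rewrite hornerX mulrBl [_ * X w]mulrC.
  - apply: cvgM; first exact: cvg_cst.
    by rewrite -subr_gt0; exact: sin_scale_step.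
  - by rewrite normrM ler_piMr//; case: (_ < _)%R; rewrite ?normr0 ?normr1.
by under eq_fun do rewrite step; exact: lim_cst.
Qed.

End OneVariable.

End Expectation.

(** * Vanishing Fourier integrals for families and the generated $\sigma$-algebra *)

Section Independence.
Context d (T : measurableType d) {R : realType} (mu : probability T R).
Implicit Types (f g X Y Z : T -> R).

Local Notation integrable f := (mu.-integrable setT (EFin \o f)).

Lemma measurable_lincomb (I : Type) (X : I -> T -> R) (s : seq (R * I)) :
  (forall i, measurable_fun setT (X i)) ->
  measurable_fun setT (fun w => \sum_(j <- s) j.1 * X j.2 w).
Proof.
move=> mX; elim: s => [|j s IHs].
  by under eq_fun do rewrite big_nil; exact: measurable_cst.
under eq_fun do rewrite big_cons.
by apply: measurable_funD => //; apply: measurable_funM.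
Qed.

Lemma measurable_rays (I : Type) (X : I -> T -> R) (l : seq (R * I)) :
  (forall i, measurable_fun setT (X i)) ->
  measurable_fun setT (fun w => \prod_(j <- l) (j.1 < X j.2 w)%R%:R : R).
Proof.
move=> mX; elim: l => [|j l IHl].
  by under eq_fun do rewrite big_nil; exact: measurable_cst.
under eq_fun do rewrite big_cons.
apply: measurable_funM => //.
apply: (measurableT_comp (f := fun b : bool => (b%:R : R))) => //.
exact: measurable_fun_ltr.
Qed.

Lemma rays_all (I : Type) (X : I -> T -> R) (l : seq (R * I)) w :
  \prod_(j <- l) (j.1 < X j.2 w)%R%:R = (all (fun j => j.1 < X j.2 w) l)%:R :> R.
Proof.
elim: l => [|j l IHl]; first by rewrite big_nil.
by rewrite big_cons IHl /=; case: (_ < _)%R; rewrite ?mul1r ?mul0r.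
Qed.

Lemma Rintegral_rays_eq0 (I : Type) (X : I -> T -> R) Y : integrable Y ->
  (forall i, measurable_fun setT (X i)) ->
  (forall (s : seq (R * I)) (c : R),
     \int[mu]_w (Y w * cos (\sum_(j <- s) j.1 * X j.2 w + c)) = 0)%R ->
  forall l : seq (R * I),
    (\int[mu]_w (Y w * \prod_(j <- l) (j.1 < X j.2 w)%R%:R) = 0)%R.
Proof.
move=> Yi mX YX l.
have mcos s c : measurable_fun setT (fun w => cos (\sum_(j <- s) j.1 * X j.2 w + c)).
  under eq_fun do rewrite -[\sum_(_ <- _) _]mul1r.
  by apply: measurable_cos_affine; exact: measurable_lincomb.
have iYl l' : integrable (fun w => Y w * \prod_(j <- l') (j.1 < X j.2 w)%R%:R).
  apply: (@integrableM_bounded _ _ _ _ _ _ 1) => //; first exact: measurable_rays.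
  by move=> w; rewrite rays_all; case: all; rewrite ?normr0 ?normr1.
have iYlc l' s c : integrable (fun w => Y w * \prod_(j <- l') (j.1 < X j.2 w)%R%:R *
    cos (\sum_(j <- s) j.1 * X j.2 w + c)).
  by apply: (@integrableM_bounded _ _ _ _ _ _ 1) => // w; exact: cos_max.
(* Carrying a cosine factor lets the rays be removed one at a time by [Rintegral_ray_eq0].
   Frequencies form a list in which indices may repeat, so a new frequency is just a cons. *)
suff H s c : (\int[mu]_w (Y w * \prod_(j <- l) (j.1 < X j.2 w)%R%:R *
    cos (\sum_(j <- s) j.1 * X j.2 w + c)) = 0)%R.
  rewrite -[RHS](H [::] 0); apply: eq_Rintegral => w _.
  by rewrite big_nil addr0 cos0 mulr1.
elim: l s c => [|[a i] l IHl] s c.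
  rewrite -[RHS](YX s c); apply: eq_Rintegral => w _.
  by rewrite big_nil mulr1.
pose Z w := Y w * \prod_(j <- l) (j.1 < X j.2 w)%R%:R *
    cos (\sum_(j <- s) j.1 * X j.2 w + c).
transitivity (\int[mu]_w (Z w * (a < X i w)%R%:R))%R.
  by apply: eq_Rintegral => w _; rewrite big_cons /Z /=; ring.
apply: Rintegral_ray_eq0 => //; first exact: iYlc.
move=> t c'.
transitivity (\int[mu]_w (1 / 2 *
   (Y w * \prod_(j <- l) (j.1 < X j.2 w)%R%:R *
      cos (\sum_(j <- (t, i) :: s) j.1 * X j.2 w + (c + c')) +
    Y w * \prod_(j <- l) (j.1 < X j.2 w)%R%:R *
      cos (\sum_(j <- (- t, i) :: s) j.1 * X j.2 w + (c - c')))))%R.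
  apply: eq_Rintegral => w _; rewrite /Z -mulrA cosMcos !big_cons /=.
  rewrite (_ : _ + c + (t * X i w + c') =
     t * X i w + \sum_(j <- s) j.1 * X j.2 w + (c + c')); last by ring.
  rewrite (_ : _ + c - (t * X i w + c') =
     - t * X i w + \sum_(j <- s) j.1 * X j.2 w + (c - c')); last by ring.
  by ring.
by apply: Rintegral_halfD; rewrite ?IHl//; exact: iYlc.
Qed.

(* The hypothesis says that the Fourier transforms of the images of the signed
   measure [Y mu] under finite families of the [X i] vanish. *)
Lemma integral_sigma_eq0 (I : Type) (X : I -> T -> R) Y : integrable Y ->
  (forall i, measurable_fun setT (X i)) ->
  (forall (s : seq (R * I)) (c : R),
     \int[mu]_w (Y w * cos (\sum_(j <- s) j.1 * X j.2 w + c)) = 0)%R ->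
  forall (S : set (set T)) (D : set T),
    (forall A, S A -> exists i (B : set R), measurable B /\ A = X i @^-1` B) ->
    <<s S >> D -> measurable D /\ (\int[mu]_(w in D) (Y w)%:E = 0)%E.
Proof.
move=> Yi mX YX S D SX SD.
(* Finite intersections of rays form a $\pi$-system: concatenation of lists is intersection, and the
   empty list is the whole space. *)
pose G := [set A : set T | exists l : seq (R * I),
  A = [set w | all (fun j => j.1 < X j.2 w) l]].
have GI : setI_closed G.
  move=> _ _ [l1 ->] [l2 ->]; exists (l1 ++ l2).
  by apply/seteqP; split => w /=; rewrite all_cat; [case=> -> ->|case/andP].
have GT : G setT by exists [::]; apply/seteqP; split.
have mG : G `<=` d.-measurable.
  move=> _ [l ->].
  rewrite (_ : [set _ | _] = (fun w => \prod_(j <- l) (j.1 < X j.2 w)%R%:R : R) @^-1` [set 1]).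
    rewrite -[X in measurable X]setTI; apply: measurable_rays => //.
  apply/seteqP; split => w /=; rewrite rays_all; case: all => //.
  by move=> /eqP; rewrite eq_sym oner_eq0.
have iD (A : set T) : measurable A -> mu.-integrable A (EFin \o Y).
  by move=> mA; apply: integrableS Yi.
have GP : <<s G >> `<=` [set A | measurable A /\ (\int[mu]_(w in A) (Y w)%:E = 0)%E].
  apply: lambda_system_subset => //.
    apply/dynkin_lambda_system; split => /=.
    - split=> //; have [l lT] := GT.
      have := Rintegral_rays_eq0 Yi mX YX [::].
      under eq_Rintegral do rewrite big_nil mulr1.
      move=> Y0; rewrite -[LHS]fineK; first by rewrite [fine _]Y0.
      exact: integrable_fin_num.
    - move=> A [mA A0]; split; first exact: measurableC.
      have := Rintegral_rays_eq0 Yi mX YX [::].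
      under eq_Rintegral do rewrite big_nil mulr1.
      move=> Y0; have YT : (\int[mu]_(w in setT) (Y w)%:E = 0)%E.
        rewrite -[LHS]fineK; first by rewrite [fine _]Y0.
        exact: integrable_fin_num.
      rewrite -YT -(setvU A) integral_setU_EFin ?A0 ?adde0//.
      + exact: measurableC.
      + by rewrite setvU; exact: integrable_measurable Yi.
      + by apply/disj_setPS => w [].
    - move=> F tF PF; split; first by apply: bigcupT_measurable => k; case: (PF k).
      rewrite integral_bigcup//.
      + by apply: eseries0 => k _ _; case: (PF k).
      + by move=> k; case: (PF k).
      + by apply: iD; apply: bigcupT_measurable => k; case: (PF k).
  move=> A GA; split; first exact: mG.
  have [l AE] := GA; rewrite integral_mkcond.
  have := Rintegral_rays_eq0 Yi mX YX l; rewrite /Rintegral.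
  rewrite (_ : (fun w => _) = ((EFin \o Y) \_ A)%E); last first.
    apply/funext => w; rewrite rays_all /patch AE; case: ifPn.
      by rewrite inE /= => ->; rewrite mulr1.
    by rewrite notin_setE /= => /negP/negbTE ->; rewrite mulr0.
  move=> Y0; rewrite -[LHS]fineK; first by rewrite Y0.
  apply: integrable_fin_num => //.
  exact: (integrable_mkcond (EFin \o Y) (mG _ GA)).1 (iD _ (mG _ GA)).
apply: GP; move: D SD; apply: smallest_sub; first exact: smallest_sigma_algebra.
move=> A /SX [i [B [mB ->]]].
(* Open rays generate the Borel sets, so every generator of [<<s S >>] already lies in
   [<<s G >>]. *)
have mXG : measurable_fun setT (X i : g_sigma_algebraType G -> R).
  apply: (measurability _ (RGenOInfty.measurableE R)) => _ [_ [a ->] <-].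
  apply: sub_sigma_algebra; exists [:: (a, i)]; rewrite setTI.
  by apply/seteqP; split => w /=; rewrite in_itv/= !andbT.
by have := mXG measurableT B mB; rewrite setTI.
Qed.

End Independence.

(** * Lipschitz bounds and the small-angle limit *)

Section TrigBounds.
Context {R : realType}.
Implicit Types x y : R.

Lemma dist_sin_le x y : `|sin x - sin y| <= `|x - y|.
Proof.
wlog xy : x y / y <= x.
  move=> H; have [|/ltW] := leP y x; first exact: H.
  by rewrite (distrC (sin x)) (distrC x); exact: H.
have [] := @MVT_segment R sin cos _ _ xy.
  by apply: continuous_subspaceT => z; exact: continuous_sin.
move=> z _ ->; rewrite normrM ler_piMl//; exact: cos_max.
Qed.

Lemma norm_sin_le x : `|sin x| <= `|x|.
Proof. by have := dist_sin_le x 0; rewrite sin0 !subr0. Qed.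

Lemma dist_cos_le x y : `|cos x - cos y| <= `|x - y|.
Proof.
have cE z : cos z = sin (pi / 2 - z).
  by rewrite sinB sin_pihalf cos_pihalf mul1r mul0r subr0.
rewrite !cE (le_trans (dist_sin_le _ _))//.
by rewrite (_ : pi / 2 - x - (pi / 2 - y) = y - x) 1?distrC//; ring.
Qed.

(** This is the derivative of the sine at the origin along the sequence $x/(n+1)$, which must avoid
    0; hence the separate case $x=0$. *)
Lemma sin_scale_cvg x : n.+1%:R * sin (x / n.+1%:R) @[n --> \oo] --> x.
Proof.
have [->|x0] := eqVneq x 0.
  by under eq_fun do rewrite mul0r sin0 mulr0; exact: cvg_cst.
have [D1 D2] := @is_derive_sin R 0.
have := D1; rewrite /derivable => /cvgP /=.
have : h^-1 *: ((sin \o shift 0) (h *: 1) - sin 0) @[h --> 0^'] --> (1 : R).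
  by rewrite -[X in _ --> X]cos0 -D2.
move=> H _.
have xn0 n : x / n.+1%:R != 0 by rewrite mulf_neq0// invr_neq0.
have xn : x / n.+1%:R @[n --> \oo] --> 0^'.
  have cx : x / n.+1%:R @[n --> \oo] --> (0 : R).
    by rewrite -(mulr0 x); apply: cvgM; [exact: cvg_cst|exact: cvg_harmonic].
  move=> A A0; have := cx [set y | y != 0 -> A y] A0.
  exact: (@filterS _ \oo _ [set n | x / n.+1%:R != 0 -> A (x / n.+1%:R)]
    [set n | A (x / n.+1%:R)] (fun n h => h (xn0 n))).
have := cvg_comp _ _ xn H => /= {}H.
have : x * ((x / n.+1%:R)^-1 * sin (x / n.+1%:R)) @[n --> \oo] --> x * 1.
  apply: cvgM; first exact: cvg_cst.
  apply: cvg_trans H; apply: near_eq_cvg; apply: nearW => n /=.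
  by rewrite sin0 subr0 addr0 /GRing.scale/= mulr1.
rewrite mulr1; apply: cvg_trans; apply: near_eq_cvg; apply: nearW => n.
by rewrite mulrA invf_div mulrCA divff// mulr1.
Qed.

End TrigBounds.

(** * Second moments and completeness of $L^2$ *)

Section MeanSquare.
Context d (T : measurableType d) {R : realType} (mu : probability T R).
Implicit Types (f g X Y Z : T -> R).

Local Notation integrable f := (mu.-integrable setT (EFin \o f)).

(** Kept in the extended reals, so that it can be estimated before integrability is known. *)
Definition msq f : \bar R := (\int[mu]_w (f w ^+ 2)%:E)%E.

Lemma msq_ge0 f : (0 <= msq f)%E.
Proof. by apply: integral_ge0 => w _; rewrite lee_fin sqr_ge0. Qed.

Lemma eq_msq f g : f =1 g -> msq f = msq g.
Proof. by move=> fg; apply: eq_integral => w _; rewrite fg. Qed.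

Lemma measurable_sqr f : measurable_fun setT f ->
  measurable_fun setT (fun w => (f w ^+ 2)%:E).
Proof. by move=> mf; apply/measurable_EFinP; exact: measurable_funX. Qed.

Lemma ae_eq_msq f g : measurable_fun setT f -> measurable_fun setT g ->
  f = g %[ae mu] -> msq f = msq g.
Proof.
move=> mf mg fg; apply: ge0_ae_eq_integral => //.
- exact: measurable_sqr.
- exact: measurable_sqr.
- by move=> w _; rewrite lee_fin sqr_ge0.
- by move=> w _; rewrite lee_fin sqr_ge0.
- by apply: filterS fg => w fg _; rewrite fg.
Qed.

Lemma msqZ f (c : R) : measurable_fun setT f ->
  msq (fun w => c * f w) = ((c ^+ 2)%:E * msq f)%E.
Proof.
move=> mf; rewrite /msq -ge0_integralZl_EFin ?sqr_ge0//.
- by apply: eq_integral => w _; rewrite exprMn EFinM.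
- by move=> w _; rewrite lee_fin sqr_ge0.
- exact: measurable_sqr.
Qed.

Lemma msqD f g : measurable_fun setT f -> measurable_fun setT g ->
  (msq (fun w => f w + g w)%R <= 2%:E * msq f + 2%:E * msq g)%E.
Proof.
move=> mf mg; rewrite /msq -!ge0_integralZl_EFin//; try exact: measurable_sqr;
  try by move=> w _; rewrite lee_fin sqr_ge0.
have m2 (h : T -> R) : measurable_fun setT h -> measurable_fun setT (fun w => (2%:E * (h w ^+ 2)%:E)%E).
  by move=> mh; apply: measurable_funeM; exact: measurable_sqr.
rewrite -ge0_integralD//; try exact: m2;
  try by move=> w _; rewrite -EFinM lee_fin mulr_ge0 ?sqr_ge0.
apply: ge0_le_integral => //.
- by move=> w _; rewrite lee_fin sqr_ge0.
- by apply: measurable_sqr; exact: measurable_funD.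
- by apply: emeasurable_funD; exact: m2.
- move=> w _; rewrite -!EFinM -EFinD lee_fin.
  by have := sqr_ge0 (f w - g w); rewrite sqrrB sqrrD !mulr2n; lra.
Qed.

Lemma msqB_triangle X Y Z : measurable_fun setT X -> measurable_fun setT Y ->
  measurable_fun setT Z ->
  (msq (fun w => X w - Z w)%R <=
   2%:E * msq (fun w => X w - Y w)%R + 2%:E * msq (fun w => Y w - Z w)%R)%E.
Proof.
move=> mX mY mZ.
rewrite (@eq_msq _ (fun w => (X w - Y w) + (Y w - Z w))); last first.
  by move=> w; rewrite subrKA.
by apply: msqD; exact: measurable_funB.
Qed.

Lemma msqBC X Y : msq (fun w => X w - Y w) = msq (fun w => Y w - X w).
Proof. by apply: eq_integral => w _; rewrite -sqrrN opprB. Qed.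

Lemma msq_small_ae0 f : measurable_fun setT f ->
  (forall e : R, 0 < e -> (msq f <= e%:E)%E) -> f = cst 0 %[ae mu].
Proof.
move=> mf fe; have f0 : msq f = 0%E.
  apply/eqP; rewrite eq_le msq_ge0 andbT; apply/lee_addgt0Pr => e e0.
  by rewrite add0e; exact: fe.
have := (ae_eq_integral_abs mu measurableT (measurable_sqr mf)).1.
under eq_integral do rewrite gee0_abs ?lee_fin ?sqr_ge0//.
move=> /(_ f0); apply: filterS => w /(_ I) [] /eqP.
by rewrite sqrf_eq0 => /eqP.
Qed.

(** $(|f|-e)^2\ge0$ gives $|f|\le f^2/(2e)+e/2$, and the total mass is 1. This takes the place of
    the Cauchy-Schwarz inequality. *)
Lemma integral_abs_le_msq f (e : R) : 0 < e -> measurable_fun setT f ->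
  (msq f <= (e ^+ 2)%:E)%E -> (\int[mu]_w `|f w|%:E <= e%:E)%E.
Proof.
move=> e0 mf fe.
apply: (@le_trans _ _ (\int[mu]_w (((2 * e)^-1)%:E * (f w ^+ 2)%:E + (e / 2)%:E)%E)%E).
  apply: ge0_le_integral => //.
  - by apply/measurable_EFinP; apply: measurableT_comp.
  - apply: emeasurable_funD => //; apply: measurable_funeM; exact: measurable_sqr.
  - move=> w _; rewrite -EFinM -EFinD lee_fin -subr_ge0.
    rewrite (_ : _ - _ = (`|f w| - e) ^+ 2 / (2 * e)).
      by rewrite divr_ge0 ?sqr_ge0// mulr_ge0// ltW.
    by rewrite -[f w ^+ 2]real_normK ?num_real//; field; rewrite gt_eqF.
rewrite ge0_integralD//.
- have -> : (\int[mu]_w (e / 2)%:E = (e / 2)%:E)%E.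
    by rewrite integral_cst//= probability_setT mule1.
  rewrite ge0_integralZl_EFin//.
  + have eE : e = (2 * e)^-1 * e ^+ 2 + e / 2 by field; rewrite gt_eqF.
    rewrite [leRHS](congr1 EFin eE) EFinD leeD2r//.
    by rewrite EFinM lee_pmul2l// lte_fin invr_gt0 mulr_gt0.
  + by move=> w _; rewrite lee_fin sqr_ge0.
  + exact: measurable_sqr.
  + by rewrite invr_ge0 mulr_ge0// ltW.
- move=> w _; rewrite -EFinM lee_fin mulr_ge0 ?sqr_ge0// invr_ge0 mulr_ge0//.
  exact: ltW.
- by apply: measurable_funeM; exact: measurable_sqr.
- by move=> w _; rewrite lee_fin divr_ge0// ltW.
Qed.

Lemma msq_integrable f : measurable_fun setT f -> (msq f < +oo)%E -> integrable f.
Proof.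
move=> mf foo; apply/integrableP; split; first exact/measurable_EFinP.
have ff : msq f \is a fin_num by rewrite ge0_fin_numE// msq_ge0.
(* Adding 1 makes [e] positive and its square at least the second moment. *)
pose e := fine (msq f) + 1; have e1 : 1 <= e by rewrite lerDr fine_ge0// msq_ge0.
have fe : (msq f <= (e ^+ 2)%:E)%E.
  by rewrite -(fineK ff) lee_fin /e; have := fine_ge0 (msq_ge0 f); nra.
have e0 : 0 < e by exact: lt_le_trans e1.
by apply: le_lt_trans (integral_abs_le_msq e0 mf fe) _; rewrite ltry.
Qed.

Lemma Lnorm2_msq f : Lnorm mu 2%:E (EFin \o f) = poweR (msq f) 2^-1.
Proof.
rewrite unlock; congr (poweR _ _); apply: eq_integral => w _.
by rewrite /= powR_mulrn// real_normK ?num_real.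
Qed.

Lemma msq_Lnorm2 f : poweR (Lnorm mu 2%:E (EFin \o f)) 2 = msq f.
Proof. by rewrite Lnorm2_msq -poweRrM mulVf// poweRe1// msq_ge0. Qed.

Lemma Lfun2P f : f \in Lfun mu 2%:E <-> measurable_fun setT f /\ (msq f < +oo)%E.
Proof.
split.
  rewrite inE => /andP[]; rewrite !inE/= => mf /(poweR_lty 2).
  by rewrite msq_Lnorm2.
case=> mf foo; rewrite inE; apply/andP; rewrite !inE/=; split=> //.
by rewrite /finite_norm Lnorm2_msq poweR_lty.
Qed.

Lemma Lnorm2_cvg0P (F : nat -> T -> R) :
  (Lnorm mu 2%:E (EFin \o F n) @[n --> \oo] --> 0%E) <->
  (forall e : R, 0 < e -> \forall n \near \oo, (msq (F n) <= e%:E)%E).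
Proof.
split.
  move=> /fine_cvgP[ff /cvgrPdist_le] cv e e0.
  have se : 0 < Num.sqrt e by rewrite sqrtr_gt0.
  near=> n; rewrite -msq_Lnorm2.
  have -> : e%:E = poweR (Num.sqrt e)%:E 2.
    by rewrite poweR_EFin powR_mulrn ?sqrtr_ge0// sqr_sqrtr// ltW.
  rewrite gt0_ler_poweR ?in_itv/= ?leey ?Lnorm_ge0 ?lee_fin ?sqrtr_ge0//.
  have fn : Lnorm mu 2%:E (EFin \o F n) \is a fin_num by near: n.
  rewrite -(fineK fn) lee_fin.
  have : `|0 - fine (Lnorm mu 2%:E (EFin \o F n))| <= Num.sqrt e.
    by near: n; exact: cv.
  by rewrite sub0r normrN ger0_norm// fine_ge0// Lnorm_ge0.
move=> H.
have Lle (e : R) : 0 < e -> \forall n \near \oo, (Lnorm mu 2%:E (EFin \o F n) <= e%:E)%E.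
  move=> e0; have e20 : 0 < e ^+ 2 by rewrite exprn_gt0.
  have := H _ e20; apply: filterS => n Fn; rewrite Lnorm2_msq.
  have -> : e%:E = poweR (e ^+ 2)%:E 2^-1.
    by rewrite poweR_EFin powR12_sqrt ?sqr_ge0// sqrtr_sqr gtr0_norm.
  by rewrite gt0_ler_poweR ?in_itv/= ?leey ?msq_ge0 ?lee_fin ?sqr_ge0 ?invr_ge0.
apply/fine_cvgP; split.
  have := Lle _ ltr01; apply: filterS => n Fn.
  by rewrite ge0_fin_numE ?Lnorm_ge0// (le_lt_trans Fn)// ltry.
apply/cvgrPdist_le => e e0; have := Lle _ e0; apply: filterS => n Fn.
have fn : Lnorm mu 2%:E (EFin \o F n) \is a fin_num.
  by rewrite ge0_fin_numE ?Lnorm_ge0// (le_lt_trans Fn)// ltry.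
rewrite sub0r normrN ger0_norm ?fine_ge0 ?Lnorm_ge0//.
by rewrite -lee_fin fineK.
Unshelve. all: by end_near. Qed.

(** Convergence is required only almost everywhere: [f] is first replaced by the pointwise lower
    limit, which is measurable and to which Fatou's lemma applies. *)
Lemma fatou_le (F : nat -> T -> R) f (M : \bar R) :
  (forall n, measurable_fun setT (F n)) -> measurable_fun setT f ->
  (forall n w, 0 <= F n w) -> (forall w, 0 <= f w) ->
  (\forall w \ae mu, F n w @[n --> \oo] --> f w) ->
  (\forall n \near \oo, (\int[mu]_w (F n w)%:E <= M)%E) ->
  (\int[mu]_w (f w)%:E <= M)%E.
Proof.
move=> mF mf F0 f0 Ff FM.
have mFE n : measurable_fun setT (fun w => (F n w)%:E) by exact/measurable_EFinP.
have -> : (\int[mu]_w (f w)%:E = \int[mu]_w limn_einf (fun n => (F n w)%:E))%E.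
  apply: ge0_ae_eq_integral => //.
  - exact/measurable_EFinP.
  - rewrite (_ : (fun w => _) = (fun w => - limn_esup (fun n => - (F n w)%:E))%E).
      apply: measurableT_comp => //; apply: measurable_fun_limn_esup => n.
      exact: measurableT_comp.
    by apply/funext => w; rewrite limn_esupN oppeK.
  - by move=> w _; rewrite lee_fin.
  - move=> w _; rewrite limn_einf_lim; apply: lime_ge; first exact: is_cvg_einfs.
    apply: nearW => n; apply: le_ereal_inf_tmp => _ [m _ <-].
    by rewrite lee_fin.
  - apply: filterS Ff => w Fw _.
    have Fw' : (F n w)%:E @[n --> \oo] --> (f w)%:E.
      by apply: cvg_EFin => //; exact: nearW.
    by have [-> _] := cvg_limn_einf_sup Fw'.
apply: le_trans (fatou mu measurableT mFE _) _.
  by move=> n w _; rewrite lee_fin.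
rewrite limn_einf_lim; apply: lime_le; first exact: is_cvg_einfs.
apply: filterS FM => n; apply: le_trans.
by apply: ereal_inf_lbound; exists n => //=.
Qed.

(* [2 n^2 (1 - cos (X/n))] tends to [X^2] and has mean
   [2 n^2 (1 - exp (- v / (2 n^2))) <= v]. *)
Lemma gaussian_msq_le X (v : R) : measurable_fun setT X ->
  (forall t : R, (\int[mu]_w cos (t * X w) = expR (- (t ^+ 2 * v) / 2))%R) ->
  (msq X <= v%:E)%E.
Proof.
move=> mX XE.
have mcos (t : R) : measurable_fun setT (fun w => cos (t * X w)).
  under eq_fun do rewrite -[_ * X _]addr0.
  exact: measurable_cos_affine.
have icos (t : R) : integrable (fun w => cos (t * X w)).
  by apply: (@integrable_bounded _ _ _ _ _ 1) => // w; exact: cos_max.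
pose F n w := 2 * n.+1%:R ^+ 2 * (1 - cos (n.+1%:R^-1 * X w)).
(* The half-angle form shows both the sign of [F] and, through [sin_scale_cvg], its limit. *)
have FE n w : F n w = (2 * (n.+1%:R * sin (X w / 2 / n.+1%:R))) ^+ 2.
  rewrite /F (_ : n.+1%:R^-1 * X w = (X w / 2 / n.+1%:R) *+ 2); last first.
    have : n.+1%:R != 0 :> R by rewrite pnatr_eq0.
    by rewrite mulr2n; move: n.+1%:R => z z0; field.
  by rewrite cos_mulr2n cos2sin2 mulr2n; ring.
apply: (@fatou_le F) => //.
- move=> n; apply: measurable_funM => //; apply: measurable_funB => //.
- exact: measurable_funX.
- by move=> n w; rewrite FE sqr_ge0.
- by move=> w; exact: sqr_ge0.
- apply: aeW => w; under eq_fun do rewrite FE expr2.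
  have XW : 2 * (n.+1%:R * sin (X w / 2 / n.+1%:R)) @[n --> \oo] --> 2 * (X w / 2).
    by apply: cvgM; [exact: cvg_cst|exact: sin_scale_cvg].
  have -> : X w ^+ 2 = (2 * (X w / 2)) * (2 * (X w / 2)) by field.
  exact: cvgM.
apply: nearW => n.
have iF : integrable (F n).
  have i1 : integrable (fun w => 1 - cos (n.+1%:R^-1 * X w)).
    apply: (@integrable_bounded _ _ _ _ _ 2); first exact: measurable_funB.
    move=> w; rewrite (le_trans (ler_normB _ _))// normr1.
    by have := cos_max (n.+1%:R^-1 * X w); lra.
  exact: integrableZR.
rewrite -[leLHS]fineK; last exact: integrable_fin_num.
rewrite lee_fin -/(Rintegral mu setT (F n)) RintegralZl//; last first.
  apply: (@integrable_bounded _ _ _ _ _ 2); first exact: measurable_funB.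
  move=> w; rewrite (le_trans (ler_normB _ _))// normr1.
  by have := cos_max (n.+1%:R^-1 * X w); lra.
rewrite RintegralB//; last by apply: (@integrable_bounded _ _ _ _ _ 1) => // w; rewrite normr1.
have -> : (\int[mu]_w (1 : R) = 1)%R.
  by rewrite Rintegral_cst//= probability_setT mulr1.
rewrite XE.
have n0 : 0 < n.+1%:R :> R by rewrite ltr0n.
have : 1 - expR (- (n.+1%:R^-1 ^+ 2 * v) / 2) <= n.+1%:R^-1 ^+ 2 * v / 2.
  move: (n.+1%:R^-1 ^+ 2 * v) => a; have := expR_ge1Dx (- a / 2).
  by move: (expR _) => y; lra.
have n20 : 0 <= 2 * n.+1%:R ^+ 2 :> R by rewrite mulr_ge0// exprn_ge0// ltW.
move=> /(ler_wpM2l n20) /le_trans; apply.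
rewrite le_eqVlt; apply/orP; left; apply/eqP.
by move: n.+1%:R n0 => z z0; field; rewrite gt_eqF.
Qed.

Lemma g_sigma_measurable_fun (G : set (set T)) f : <<s G >> `<=` d.-measurable ->
  measurable_fun setT (f : g_sigma_algebraType G -> R) -> measurable_fun setT f.
Proof. by move=> Gm mf _ B mB; apply: Gm; exact: mf. Qed.

Lemma geometric_half_sum n : \sum_(0 <= k < n) (1 / 2) ^+ k <= 2 :> R.
Proof.
suff -> : \sum_(0 <= k < n) (1 / 2) ^+ k = 2 - 2 * (1 / 2) ^+ n :> R.
  by rewrite gerBl mulr_ge0// exprn_ge0// divr_ge0.
elim: n => [|n IHn]; first by rewrite big_nil expr0; ring.
by rewrite big_nat_recr//= IHn exprS; field.
Qed.

(** Second moments below $4^{-k}$ make the first moments of the increments at most $2^{-k}$. The sum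
    of the absolute increments is then integrable, hence almost everywhere finite, and the
    telescoping series converges absolutely. *)
Lemma fast_cauchy_cvg (X : nat -> T -> R) : (forall k, measurable_fun setT (X k)) ->
  (forall k, (msq (fun w => X k.+1 w - X k w)%R <= ((1 / 4) ^+ k)%:E)%E) ->
  \forall w \ae mu, cvgn (fun k => X k w).
Proof.
move=> mX Xk.
pose D k w := `|X k.+1 w - X k w|%:E.
have mD k : measurable_fun setT (D k).
  by apply/measurable_EFinP; apply: measurableT_comp => //; exact: measurable_funB.
have D0 k w : (0 <= D k w)%E by rewrite lee_fin.
have ID k : (\int[mu]_w D k w <= ((1 / 2) ^+ k)%:E)%E.
  apply: integral_abs_le_msq; first by rewrite exprn_gt0.
    exact: measurable_funB.
  rewrite -exprM mulnC exprM (_ : (1 / 2) ^+ 2 = 1 / 4 :> R); first exact: Xk.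
  by field.
have iS : mu.-integrable setT (fun w => \sum_(k <oo) D k w)%E.
  apply/integrableP; split; first exact: ge0_emeasurable_sum.
  under eq_integral do rewrite gee0_abs ?nneseries_ge0//.
  rewrite integral_nneseries//; apply: (@le_lt_trans _ _ 2%:E); last by rewrite ltry.
  apply: lime_le; first by apply: is_cvg_nneseries => n _ _; exact: integral_ge0.
  apply: nearW => n; apply: (@le_trans _ _ (\sum_(0 <= k < n) (1 / 2) ^+ k)%:E).
    by rewrite -sumEFin; apply: lee_sum => k _; exact: ID.
  by rewrite lee_fin; exact: geometric_half_sum.
have := integrable_ae measurableT iS; apply: filterS => w /(_ I) Sfin.
have cD : cvgn (series (fun n => `|telescope (fun k => X k w) n|)).
  apply: nondecreasing_is_cvgn.
    by apply/nondecreasing_seqP => n; rewrite /series/= big_nat_recr//= lerDl.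
  exists (fine (\sum_(k <oo) D k w)%E) => _ [n _ <-].
  rewrite -lee_fin fineK// /series /= -sumEFin.
  exact: (@nneseries_lim_ge _ (D ^~ w) xpredT 0%N n).
have cs := normed_cvg cD.
rewrite (_ : (fun k => X k w) = (fun k => X 0%N w + series (telescope (fun k => X k w)) k)).
  by apply: is_cvgD => //; exact: is_cvg_cst.
by apply/funext => k; exact: eq_sum_telescope.
Qed.

(** The limit is taken as an upper limit, which is defined everywhere and measurable for the
    sub-$\sigma$-algebra, so no exceptional set has to be removed. Fatou's lemma transfers the rate
    to the limit. *)
Lemma riesz_fischer (G : set (set T)) (X : nat -> T -> R) :
  <<s G >> `<=` d.-measurable ->
  (forall k, measurable_fun setT (X k : g_sigma_algebraType G -> R)) ->
  (forall k m, (k <= m)%N ->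
     (msq (fun w => X m w - X k w)%R <= ((1 / 4) ^+ k)%:E)%E) ->
  exists Y : T -> R, measurable_fun setT (Y : g_sigma_algebraType G -> R) /\
    forall k, (msq (fun w => Y w - X k w)%R <= ((1 / 4) ^+ k)%:E)%E.
Proof.
move=> Gm mXG Xkm; have mX k := g_sigma_measurable_fun Gm (mXG k).
pose Y w := fine (limn_esup (fun k => (X k w)%:E)).
have mYG : measurable_fun setT (Y : g_sigma_algebraType G -> R).
  rewrite /Y; apply: (measurableT_comp (f := @fine R)); first exact: fine_measurable.
  by apply: measurable_fun_limn_esup => k; apply/measurable_EFinP; exact: mXG.
have mY := g_sigma_measurable_fun Gm mYG.
exists Y; split=> // k.
apply: (@fatou_le (fun m w => (X m w - X k w) ^+ 2)).
- by move=> m; apply: measurable_funX; exact: measurable_funB.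
- by apply: measurable_funX; exact: measurable_funB.
- by move=> m w; exact: sqr_ge0.
- by move=> w; exact: sqr_ge0.
- have := fast_cauchy_cvg mX (fun k => Xkm k k.+1 (leqnSn k)).
  apply: filterS => w /cvg_ex[/= l Xl].
  have -> : Y w = l.
    have Xl' : (X n w)%:E @[n --> \oo] --> l%:E.
      by apply: cvg_EFin => //; exact: nearW.
    by rewrite /Y; have [_ ->] := cvg_limn_einf_sup Xl'.
  have XB : X m w - X k w @[m --> \oo] --> l - X k w.
    by apply: cvgB => //; exact: cvg_cst.
  by rewrite expr2; under eq_fun do rewrite expr2; exact: cvgM.
- near=> m; apply: Xkm; near: m; exact: nbhs_infty_ge.
Unshelve. all: by end_near. Qed.

End MeanSquare.

(** * Uniqueness of conditional expectations *)

Section CondExpUniqueness.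
Context d (T : measurableType d) {R : realType} (mu : probability T R).
Implicit Types (E F : T -> R).

(** The set where one version is smaller than the other belongs to the $\sigma$-algebra, so both
    have the same integral over it; a strictly positive difference with zero integral makes this set
    null. *)
Lemma is_cond_exp_unique (G : set (set T)) F E E' : <<s G >> `<=` d.-measurable ->
  is_cond_exp mu <<s G >> F E -> is_cond_exp mu <<s G >> F E' -> E = E' %[ae mu].
Proof.
move=> Gm.
have half E1 E2 : is_cond_exp mu <<s G >> F E1 -> is_cond_exp mu <<s G >> F E2 ->
    \forall w \ae mu, ~ E1 w < E2 w.
  move=> [mE1 iE1 IE1] [mE2 iE2 IE2].
  have mG1 : measurable_fun setT (E1 : g_sigma_algebraType G -> R).
    by move=> _ B mB; rewrite setTI; exact: mE1.
  have mG2 : measurable_fun setT (E2 : g_sigma_algebraType G -> R).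
    by move=> _ B mB; rewrite setTI; exact: mE2.
  pose D := [set w | E1 w < E2 w].
  have GD : <<s G >> D.
    have mlt := measurable_fun_ltr mG1 mG2.
    have := mlt measurableT [set true] I.
    by rewrite setTI.
  have mD := Gm _ GD.
  have i1 : mu.-integrable D (EFin \o E1) by exact: integrableS iE1.
  have i2 : mu.-integrable D (EFin \o E2) by exact: integrableS iE2.
  have ID : (\int[mu]_(w in D) `|(E2 w - E1 w)%:E| = 0)%E.
    rewrite -[RHS](@subee _ (\int[mu]_(w in D) (E2 w)%:E)%E); last first.
      exact: integrable_fin_num.
    rewrite [X in (_ = _ - X)%E]IE2// -IE1// -integralB_EFin//.
    apply: eq_integral => w; rewrite inE /D/= => Ew.
    by rewrite ger0_norm ?EFinB// subr_ge0 ltW.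
  have mB : measurable_fun D (fun w => (E2 w - E1 w)%:E).
    apply/measurable_EFinP; apply: measurable_funTS; apply: measurable_funB.
      exact: g_sigma_measurable_fun mG2.
    exact: g_sigma_measurable_fun mG1.
  have := (ae_eq_integral_abs mu mD mB).1 ID; apply: filterS => w DW.
  move=> Ew; have [] := DW Ew; move=> /eqP; rewrite subr_eq0 => /eqP E21.
  by move: Ew; rewrite E21 ltxx.
move=> H H'; have h1 := half _ _ H H'; have h2 := half _ _ H' H.
apply: filterS2 h1 h2 => w h1 h2 _; apply/eqP; rewrite eq_le.
by rewrite !leNgt; apply/andP; split; apply/negP.
Qed.

Lemma cond_expP (G : set (set T)) F E : <<s G >> `<=` d.-measurable ->
  is_cond_exp mu <<s G >> F E -> cond_exp mu <<s G >> F = E %[ae mu].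
Proof.
move=> Gm HE; apply: (is_cond_exp_unique Gm) (HE).
exact: (@xgetPex _ (cst 0) [set E0 | is_cond_exp mu <<s G >> F E0]
  (ex_intro _ E HE)).
Qed.

End CondExpUniqueness.

(** * Abstract centred Gaussian fields *)

Section GaussianField.
Context d (T : measurableType d) {R : realType} (mu : probability T R).
Context (V : lmodType R) (q : V -> V -> R) (X : V -> T -> R).
Hypothesis qC : forall u v, q u v = q v u.
Hypothesis qP : forall (a : R) u v z, q (a *: u + v) z = a * q u z + q v z.
Hypothesis mX : forall u, measurable_fun setT (X u).
Hypothesis X_lin : forall (a : R) u v,
  X (a *: u + v) = (fun w => a * X u w + X v w) %[ae mu].
Hypothesis X_cos : forall u, (\int[mu]_w cos (X u w) = expR (- q u u / 2))%R.
Hypothesis X_sin : forall u, (\int[mu]_w sin (X u w) = 0)%R.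

Local Notation integrable f := (mu.-integrable setT (EFin \o f)).

Lemma ae_eq_Rintegral (f g : T -> R) : measurable_fun setT f ->
  measurable_fun setT g -> f = g %[ae mu] ->
  (\int[mu]_w f w = \int[mu]_w g w)%R.
Proof.
move=> mf mg fg; congr fine; apply: ae_eq_integral => //;
  try exact/measurable_EFinP.
by apply: filterS fg => w fg _; rewrite fg.
Qed.

Let qsq (a : R) u v : q (a *: u + v) (a *: u + v) =
  a ^+ 2 * q u u + 2 * a * q u v + q v v.
Proof. by rewrite qP !(qC _ (a *: u + v)) !qP (qC v u); ring. Qed.

Let q0 z : q 0 z = 0.
Proof. by have := qP (-1) 0 0 z; rewrite scaler0 addr0 mulN1r addNr. Qed.

Let mcos u (c : R) : measurable_fun setT (fun w => cos (X u w + c)).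
Proof.
by under eq_fun do rewrite -[X u _]mul1r; exact: measurable_cos_affine.
Qed.

Let X0 : X 0 = cst 0 %[ae mu].
Proof.
have := X_lin 1 0 0; rewrite scaler0 addr0; apply: filterS => w /(_ I) X0 _.
by rewrite mul1r in X0; move: X0 => /= X0; lra.
Qed.

Lemma gaussian_field_scale u (t : R) :
  (\int[mu]_w cos (t * X u w) = expR (- (t ^+ 2 * q u u) / 2))%R.
Proof.
have -> : t ^+ 2 * q u u = q (t *: u + 0) (t *: u + 0).
  by rewrite qsq (qC u 0) !q0; ring.
rewrite -X_cos; apply: ae_eq_Rintegral.
- by under eq_fun do rewrite -[_ * X u _]addr0; exact: measurable_cos_affine.
- by under eq_fun do rewrite -[X _ _]addr0; exact: mcos.
- have := X_lin t u 0; apply: filterS2 X0 => w X0w Xw Iw.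
  by rewrite Xw// X0w// addr0.
Qed.

Lemma gaussian_field_msq u : (msq mu (X u) <= (q u u)%:E)%E.
Proof. by apply: gaussian_msq_le => // t; exact: gaussian_field_scale. Qed.

Lemma gaussian_field_integrable u : integrable (X u).
Proof.
apply: msq_integrable => //.
by apply: le_lt_trans (gaussian_field_msq u) _; rewrite ltry.
Qed.

Lemma gaussian_field_shift u (c : R) :
  (\int[mu]_w cos (X u w + c) = expR (- q u u / 2) * cos c)%R.
Proof.
have icos : integrable (fun w => cos (X u w)).
  apply: (@integrable_bounded _ _ _ _ _ 1); last by move=> w; exact: cos_max.
  by under eq_fun do rewrite -[X _ _]addr0; exact: mcos.
have isin : integrable (fun w => sin (X u w)).
  apply: (@integrable_bounded _ _ _ _ _ 1); last by move=> w; exact: sin_max.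
  by under eq_fun do rewrite sinE_cos; exact: mcos.
transitivity (\int[mu]_w (cos c * cos (X u w) - sin c * sin (X u w)))%R.
  by apply: eq_Rintegral => w _; rewrite cosD; ring.
rewrite RintegralB//; try exact: integrableZR.
by rewrite !RintegralZl// X_cos X_sin mulr0 subr0 mulrC.
Qed.

Let XZ (a : R) u : X (a *: u) = (fun w => a * X u w) %[ae mu].
Proof.
have := X_lin a u 0; rewrite addr0; apply: filterS2 X0 => w X0w Xw Iw.
by rewrite Xw// X0w//= addr0.
Qed.

(** If $q(g,u)=0$, then $sg+u$ and $sg-u$ have the same variance, so the two terms of
    $\sin(sX_g)\cos(X_u+c)$ integrate to opposite multiples of $\sin c$. Taking $s=1/(n+1)$ and
    multiplying by $n+1$ leads to $X_g$ in the limit. *)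
Lemma gaussian_field_uncorrelated g u (c : R) : q g u = 0 ->
  (\int[mu]_w (X g w * cos (X u w + c)) = 0)%R.
Proof.
move=> gu.
have step (s : R) : (\int[mu]_w (sin (s * X g w) * cos (X u w + c)) = 0)%R.
  have i1 z b : integrable (fun w => cos (X z w + b)).
    by apply: (@integrable_bounded _ _ _ _ _ 1) => // w; exact: cos_max.
  transitivity (\int[mu]_w (1 / 2 * (cos (X (s *: g + u) w + (c - pi / 2)) +
      cos (X (s *: g + -1 *: u) w + (- c - pi / 2)))))%R.
    apply: ae_eq_Rintegral.
    - apply: measurable_funM; last exact: mcos.
      by under eq_fun do rewrite sinE_cos; exact: measurable_cos_affine.
    - by apply: measurable_funM => //; apply: measurable_funD; exact: mcos.
    - apply: filterS3 (X_lin s g u) (X_lin s g (-1 *: u)) (XZ (-1) u).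
      move=> w a1 a2 a3 Iw; rewrite a1// a2// a3// sinMcos.
      by congr (_ * (cos _ + cos _)); ring.
  rewrite RintegralZl//; last exact: integrableDR.
  rewrite RintegralD// !gaussian_field_shift -!sinE_cos sinN.
  rewrite !qsq -[-1 *: u]addr0 (qC _ (-1 *: u + 0)) !qP (qC u g) gu !q0.
  rewrite (qC u (-1 *: u + 0)) qP q0.
  rewrite (_ : s ^+ 2 * q g g + 2 * s * (-1 * 0 + 0) + _ =
    s ^+ 2 * q g g + 2 * s * 0 + q u u); last by ring.
  by move: (expR _) => y; ring.
have igX := gaussian_field_integrable g.
rewrite -[RHS](_ : limn (fun n : nat => \int[mu]_w
    (n.+1%:R * sin (X g w / n.+1%:R) * cos (X u w + c)))%R = 0).
  apply/esym/cvg_lim => //.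
  apply: (@Rintegral_cvg _ _ _ _ _ _ (fun w => `|X g w|)).
  - move=> n; apply: measurable_funM; last exact: mcos.
    apply: measurable_funM => //; under eq_fun do rewrite mulrC sinE_cos.
    exact: measurable_cos_affine.
  - by move=> w; apply: cvgM; [exact: sin_scale_cvg|exact: cvg_cst].
  - exact: integrable_norm.
  - move=> n w; rewrite normrM -[leRHS]mulr1 ler_pM//; last exact: cos_max.
    rewrite normrM; apply: (@le_trans _ _ (`|n.+1%:R| * `|X g w / n.+1%:R|)).
      by rewrite ler_wpM2l// norm_sin_le.
    by rewrite -normrM mulrCA divff ?mulr1// pnatr_eq0.
rewrite (_ : (fun n : nat => _) = cst 0); first exact: lim_cst.
apply/funext => n; rewrite /cst -[RHS](mulr0 n.+1%:R) -[in RHS](step n.+1%:R^-1).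
rewrite -RintegralZl//.
  by apply: eq_Rintegral => w _; rewrite mulrA [_^-1 * _]mulrC.
apply: (@integrable_bounded _ _ _ _ _ 1).
  apply: measurable_funM; last exact: mcos.
  by under eq_fun do rewrite sinE_cos; exact: measurable_cos_affine.
by move=> w; rewrite normrM mulr_ile1// ?cos_max ?sin_max.
Qed.

Lemma gaussian_field_sum (I : Type) (e : I -> V) (s : seq (R * I)) :
  X (\sum_(j <- s) j.1 *: e j.2) = (fun w => \sum_(j <- s) j.1 * X (e j.2) w) %[ae mu].
Proof.
elim: s => [|j s IHs].
  by rewrite big_nil; apply: filterS X0 => w X0w Iw; rewrite X0w// big_nil.
rewrite big_cons.
have := X_lin j.1 (e j.2) (\sum_(j <- s) j.1 *: e j.2).
by apply: filterS2 IHs => w IHw Xw Iw; rewrite Xw// IHw// big_cons.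
Qed.

(** A finite combination of the [X (e i)] is almost everywhere the variable of the combined vector,
    so orthogonality to each [e i] settles all frequencies at once. *)
Lemma gaussian_field_indep (I : Type) (e : I -> V) g (S : set (set T)) (D : set T) :
  (forall i, q g (e i) = 0) ->
  (forall A, S A -> exists i (B : set R), measurable B /\ A = X (e i) @^-1` B) ->
  <<s S >> D -> measurable D /\ (\int[mu]_(w in D) (X g w)%:E = 0)%E.
Proof.
move=> ge; apply: integral_sigma_eq0 => //; first exact: gaussian_field_integrable.
move=> s c; rewrite -[RHS](@gaussian_field_uncorrelated g (\sum_(j <- s) j.1 *: e j.2) c).
  apply: ae_eq_Rintegral.
  - apply: measurable_funM => //; under eq_fun do rewrite -[\sum_(_ <- _) _]mul1r.
    apply: measurable_cos_affine.
    exact: (measurable_lincomb (X := fun i => X (e i))).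
  - by apply: measurable_funM => //; exact: mcos.
  - apply: filterS (gaussian_field_sum e s) => w Xw Iw.
    by rewrite Xw.
rewrite qC; elim: s => [|j s IHs]; first by rewrite big_nil q0.
by rewrite big_cons qP IHs qC ge mulr0 addr0.
Qed.

(** Positivity is inherited from the second moment, which the form dominates. *)
Let q_ge0 u : 0 <= q u u.
Proof. by rewrite -lee_fin (le_trans (msq_ge0 mu (X u)))// gaussian_field_msq. Qed.

Let qB u v z : q (u - v) (u - v) <= 2 * q (u - z) (u - z) + 2 * q (v - z) (v - z).
Proof.
have -> : u - v = -1 *: (v - z) + (u - z) by rewrite scaleN1r opprB [RHS]addrC subrKA.
have := q_ge0 (1 *: (v - z) + (u - z)); rewrite !qsq.
by move: (q _ _) (q (v - z) _) (q (u - z) _) => a b c; lra.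
Qed.

Lemma gaussian_field_msqB u v :
  (msq mu (fun w => X u w - X v w)%R <= (q (u - v) (u - v))%:E)%E.
Proof.
rewrite (@ae_eq_msq _ _ _ mu _ (X (-1 *: v + u))).
- by rewrite scaleN1r addrC gaussian_field_msq.
- exact: measurable_funB.
- exact: mX.
- apply: filterS (X_lin (-1) v u) => w Xw Iw.
  by rewrite Xw// mulN1r addrC.
Qed.

(* [X p] is only almost everywhere equal to a function measurable for the
   sigma-algebra: the latter is an L2-limit of finite combinations of the
   [X (e i)]. *)
Lemma gaussian_field_version (I : Type) (e : I -> V) p (S : set (set T)) :
  (forall i (B : set R), measurable B -> S (X (e i) @^-1` B)) ->
  <<s S >> `<=` d.-measurable ->
  (forall eps : R, 0 < eps -> exists s : seq (R * I),
     q (\sum_(j <- s) j.1 *: e j.2 - p) (\sum_(j <- s) j.1 *: e j.2 - p) <= eps) ->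
  exists Y : T -> R, measurable_fun setT (Y : g_sigma_algebraType S -> R) /\
    Y = X p %[ae mu].
Proof.
move=> XS Sm dense_p.
(* The extra quarter absorbs the factors 2 of [qB]: for $k\le m$ the approximants [v k] and [v m]
   have squared distance at most $4^{-k}$, the rate asked for by [riesz_fischer]. *)
have h4 (k : nat) : 0 < (1 / 4) ^+ k / 4 :> R by rewrite divr_gt0// exprn_gt0// divr_gt0.
have [s sP] := choice (fun k => dense_p _ (h4 k)).
pose v k := \sum_(j <- s k) j.1 *: e j.2.
pose Z k w := \sum_(j <- s k) j.1 * X (e j.2) w.
have mZS k : measurable_fun setT (Z k : g_sigma_algebraType S -> R).
  apply: (measurable_lincomb (T := g_sigma_algebraType S) (X := fun i => X (e i))).
  by move=> i _ B mB; rewrite setTI; apply: sub_sigma_algebra; exact: XS.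
have mZ k := g_sigma_measurable_fun Sm (mZS k).
have ZX k : Z k = X (v k) %[ae mu].
  by apply: filterS (gaussian_field_sum e (s k)) => w Xw Iw; rewrite /v Xw.
have Zkm k m : (k <= m)%N ->
    (msq mu (fun w => Z m w - Z k w)%R <= ((1 / 4) ^+ k)%:E)%E.
  move=> km; rewrite (@ae_eq_msq _ _ _ mu _ (fun w => X (v m) w - X (v k) w)).
  - apply: le_trans (gaussian_field_msqB _ _) _; rewrite lee_fin.
    apply: le_trans (qB _ _ p) _.
    have mk : (1 / 4) ^+ m <= (1 / 4) ^+ k :> R.
      by apply: ler_wiXn2l => //; lra.
    by have := sP m; have := sP k; rewrite -!/(v _); lra.
  - exact: measurable_funB.
  - exact: measurable_funB.
  - by apply: filterS2 (ZX k) (ZX m) => w Zk Zm Iw; rewrite Zk// Zm.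
have [Y [mYS YZ]] := riesz_fischer Sm mZS Zkm.
have mY := g_sigma_measurable_fun Sm mYS.
exists Y; split=> //.
have : (fun w => Y w - X p w) = cst 0 %[ae mu].
  apply: msq_small_ae0; first exact: measurable_funB.
  move=> eps eps0.
  (* Going from [Y] to [X p] through [Z k] costs $2\cdot4^{-k}$ plus $2\cdot4^{-k}/4$, which is
     below $4\cdot4^{-k}$. *)
  have /cvgrPdist_lt/(_ _ eps0) [k _ kP] : 4 * (1 / 4) ^+ k @[k --> \oo] --> (0 : R).
    rewrite -(mulr0 4); apply: cvgM; first exact: cvg_cst.
    by apply: cvg_expr; rewrite ger0_norm; lra.
  have /= := kP k (leqnn _); rewrite sub0r normrN ger0_norm; last first.
    by rewrite mulr_ge0// exprn_ge0// divr_ge0.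
  move=> keps; apply: le_trans (msqB_triangle mu mY (mZ k) (mX p)) _.
  rewrite (@ae_eq_msq _ _ _ mu (fun w => Z k w - X p w) (fun w => X (v k) w - X p w)).
  - apply: (@le_trans _ _ (2%:E * ((1 / 4) ^+ k)%:E + 2%:E * ((1 / 4) ^+ k / 4)%:E)%E).
      apply: leeD; rewrite lee_pmul2l ?lte_fin//.
      by apply: le_trans (gaussian_field_msqB _ _) _; rewrite lee_fin; exact: sP.
    by rewrite -!EFinM -EFinD lee_fin; move: keps; have := h4 k; lra.
  - exact: measurable_funB.
  - exact: measurable_funB.
  - by apply: filterS (ZX k) => w Zk Iw; rewrite Zk.
by apply: filterS => w Yw Iw; apply/eqP; rewrite -subr_eq0 Yw.
Qed.

(** The description of [S] serves in both directions: independence needs every generator to come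
    from some [X (e i)], the measurable version needs every such preimage to be a generator. *)
Lemma gaussian_field_cond_exp (I : Type) (e : I -> V) p g (S : set (set T)) :
  (forall i, q g (e i) = 0) ->
  (forall A, S A <-> exists i (B : set R), measurable B /\ A = X (e i) @^-1` B) ->
  (forall eps : R, 0 < eps -> exists s : seq (R * I),
     q (\sum_(j <- s) j.1 *: e j.2 - p) (\sum_(j <- s) j.1 *: e j.2 - p) <= eps) ->
  cond_exp mu <<s S >> (X (p + g)) = X p %[ae mu].
Proof.
move=> ge SE dense_p.
have indep D (SD : <<s S >> D) := gaussian_field_indep ge (fun A => (SE A).1) SD.
have Sm : <<s S >> `<=` d.-measurable by move=> D /indep[].
have XS i (B : set R) : measurable B -> S (X (e i) @^-1` B).
  by move=> mB; apply/SE; exists i, B.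
have [Y [mYS YX]] := gaussian_field_version XS Sm dense_p.
have mY := g_sigma_measurable_fun Sm mYS.
have YE : is_cond_exp mu <<s S >> (X (p + g)) Y.
  split.
  - by move=> B mB; have := mYS measurableT B mB; rewrite setTI.
  - apply: msq_integrable => //; rewrite (ae_eq_msq mY (mX p) YX).
    by apply: le_lt_trans (gaussian_field_msq p) _; rewrite ltry.
  - move=> D SD; have [mD Dg0] := indep D SD.
    have mXE u : measurable_fun D (fun w => (X u w)%:E).
      by apply/measurable_EFinP; exact: measurable_funTS.
    have iXD u : mu.-integrable D (EFin \o X u).
      by apply: integrableS (gaussian_field_integrable u).
    rewrite (@ae_eq_integral _ _ _ mu D (fun w => (X p w)%:E) (fun w => (Y w)%:E))//;
      last 2 first.
    + by apply/measurable_EFinP; exact: measurable_funTS.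
    + by apply: filterS YX => w Yw _; rewrite Yw.
    rewrite (@ae_eq_integral _ _ _ mu D (fun w => (X p w + X g w)%:E)
      (fun w => (X (p + g) w)%:E))//; last 2 first.
    + by apply/measurable_EFinP; apply: measurable_funD; exact: measurable_funTS.
    + apply: filterS (X_lin 1 p g) => w; rewrite scale1r => Xw _.
      by rewrite Xw// mul1r.
    by rewrite integralD_EFin//= Dg0 adde0.
by apply: filterS2 (cond_expP Sm YE) YX => w -> // ->.
Qed.

End GaussianField.

Lemma cvg_sum_nat {R : realType} (F : nat -> nat -> R) (l : nat -> R) m :
  (forall i, F i n @[n --> \oo] --> l i) ->
  \sum_(0 <= i < m) F i n @[n --> \oo] --> \sum_(0 <= i < m) l i.
Proof.
move=> Fl; elim: m => [|m IHm].
  by rewrite big_nil; under eq_fun do rewrite big_nil; exact: cvg_cst.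
by rewrite big_nat_recr//=; under eq_fun do rewrite big_nat_recr//=; exact: cvgD.
Qed.

Lemma ler_sqr_mono {R : realDomainType} (x y : R) : 0 <= x -> x <= y ->
  x ^+ 2 <= y ^+ 2.
Proof. by move=> x0 xy; rewrite lerXn2r ?nnegrE// (le_trans x0). Qed.

(** * Orthonormal expansions in a Hilbert space *)

Section HilbertBasis.
Context {R : realType} {V : hilbertType R}.
Implicit Types (x y z : V) (a : R).

Lemma dotZl a x z : dot (a *: x) z = a * dot x z.
Proof.
have d0 : dot (0 : V) z = 0.
  by have := dotPl (-1) 0 0 z; rewrite scaler0 addr0 mulN1r addNr.
by have := dotPl a x 0 z; rewrite !addr0 d0 addr0.
Qed.

Lemma dot0l z : dot 0 z = 0. Proof. by rewrite -(scale0r 0) dotZl mul0r. Qed.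

Lemma dotBl x y z : dot (x - y) z = dot x z - dot y z.
Proof. by rewrite dotDl -scaleN1r dotZl mulN1r. Qed.

Lemma dotDr x y z : dot z (x + y) = dot z x + dot z y.
Proof. by rewrite !(dotC z) dotDl. Qed.

Lemma dotZr a x z : dot z (a *: x) = a * dot z x.
Proof. by rewrite !(dotC z) dotZl. Qed.

Lemma dotBr x y z : dot z (x - y) = dot z x - dot z y.
Proof. by rewrite !(dotC z) dotBl. Qed.

Lemma dot_suml (I : Type) (r : seq I) (F : I -> V) z :
  dot (\sum_(i <- r) F i) z = \sum_(i <- r) dot (F i) z.
Proof.
elim: r => [|i r IHr]; first by rewrite !big_nil dot0l.
by rewrite !big_cons dotDl IHr.
Qed.

Lemma dot_sumr (I : Type) (r : seq I) (F : I -> V) z :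
  dot z (\sum_(i <- r) F i) = \sum_(i <- r) dot z (F i).
Proof. by rewrite dotC dot_suml; under eq_bigr do rewrite dotC. Qed.

Lemma norm_dot_le x y : `|dot x y| <= `|x| * `|y|.
Proof.
have := ip_CauchySchwarz (@dot_inner_product R V) x y; rewrite !dot_norm => h.
rewrite -[leRHS]ger0_norm ?mulr_ge0// -!sqrtr_sqr ler_wsqrtr//.
by rewrite exprMn.
Qed.

Lemma cvg_dotr (I : Type) (F : set_system I) {FF : Filter F} (f : I -> V) x y :
  f i @[i --> F] --> x -> dot y (f i) @[i --> F] --> dot y x.
Proof.
move=> /cvgrPdist_lt fx; apply/cvgrPdist_lt => e e0.
have y0 : 0 < `|y| + 1 by rewrite ltr_wpDl.
have := fx _ (divr_gt0 e0 y0); apply: filterS => i fi.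
rewrite -dotBr (le_lt_trans (norm_dot_le _ _))//.
apply: (@le_lt_trans _ _ ((`|y| + 1) * `|x - f i|)).
  by rewrite ler_wpM2r// lerDl.
by rewrite mulrC -ltr_pdivlMr.
Qed.

Lemma dot_eq x y : (forall z, dot z x = dot z y) -> x = y.
Proof.
move=> xy; apply/eqP; rewrite -subr_eq0 -normr_eq0 -sqrf_eq0 -dot_norm.
by rewrite dotBr xy subrr.
Qed.

Section Orthonormal.
Variable e : nat -> V.
Hypothesis e_basis : orthonormal_basis e.

Let ee i j : dot (e i) (e j) = (i == j)%:R. Proof. by case: e_basis. Qed.

Lemma dot_orthonormal_sum n (c : nat -> R) i :
  dot (e i) (\sum_(0 <= k < n) c k *: e k) = if (i < n)%N then c i else 0.
Proof.
rewrite dot_sumr; under eq_bigr do rewrite dotZr ee.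
elim: n => [|n IHn]; first by rewrite big_nil.
rewrite big_nat_recr//= IHn [(i < n.+1)%N]ltnS [(i <= n)%N]leq_eqVlt.
have [->|_] /= := eqVneq i n; first by rewrite ltnn mulr1 add0r.
by rewrite mulr0 addr0.
Qed.

(** Completing the square isolates the coefficients in the last sum, which yields both Bessel's
    inequality and the optimality of the Fourier coefficients. *)
Lemma norm_sub_orthonormal_sum n (c : nat -> R) x :
  `|x - \sum_(0 <= k < n) c k *: e k| ^+ 2 =
  `|x| ^+ 2 - \sum_(0 <= k < n) dot (e k) x ^+ 2 +
  \sum_(0 <= k < n) (c k - dot (e k) x) ^+ 2.
Proof.
elim: n => [|n IHn]; first by rewrite !big_nil !subr0 addr0.
have eS : dot (e n) (\sum_(0 <= k < n) c k *: e k) = 0.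
  by rewrite dot_orthonormal_sum ltnn.
rewrite !big_nat_recr//= opprD addrA.
move: IHn eS; set S := \sum_(0 <= k < n) c k *: e k => IHn eS.
have re : dot (x - S) (e n) = dot (e n) x.
  by rewrite dotBl (dotC S) eS subr0 dotC.
move: IHn re; move: (x - S) => r IHn re.
rewrite -dot_norm dotBl !dotBr !dotZl !dotZr (dotC (e n) r) re ee eqxx.
by rewrite (_ : true%:R = 1 :> R)// dot_norm IHn; ring.
Qed.

Lemma bessel n x : \sum_(0 <= k < n) dot (e k) x ^+ 2 <= `|x| ^+ 2.
Proof.
have := norm_sub_orthonormal_sum n (fun k => dot (e k) x) x.
rewrite [X in _ = _ + X]big1 => [|k _]; last by rewrite subrr expr0n.
by rewrite addr0 -subr_ge0 => <-; exact: sqr_ge0.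
Qed.

(** Density provides some combination within [eps]; Fourier coefficients of the same length do at
    least as well, and longer sums only lower the error. *)
Lemma orthonormal_expansion x :
  \sum_(0 <= k < n) dot (e k) x *: e k @[n --> \oo] --> x.
Proof.
apply/cvgrPdist_lt => eps eps0.
have [_ _ /(_ x _ I eps0) [m [c xc]]] := e_basis.
have xcE : `|x - \sum_(0 <= k < m) c k *: e k| < eps.
  by rewrite big_mkord; move: xc; rewrite /ipnorm dot_norm sqrtr_sqr normr_id.
exists m => // n /= mn; apply: le_lt_trans xcE.
rewrite -(@ler_pXn2r _ 2)// ?nnegrE// !norm_sub_orthonormal_sum.
rewrite [X in _ - _ + X]big1 => [|k _]; last by rewrite subrr expr0n.
rewrite addr0 (@big_cat_nat _ _ _ m 0 n)//= opprD addrA.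
rewrite lerD// -subr_ge0 opprK ?addr_ge0// ?sumr_ge0// => *; exact: sqr_ge0.
Qed.

Lemma parseval x : \sum_(0 <= k < n) dot (e k) x ^+ 2 @[n --> \oo] --> `|x| ^+ 2.
Proof.
have : dot x (\sum_(0 <= k < n) dot (e k) x *: e k) @[n --> \oo] --> dot x x.
  by apply: cvg_dotr; exact: orthonormal_expansion.
rewrite dot_norm.
under eq_fun do rewrite dot_sumr.
by under eq_fun do under eq_bigr do rewrite dotZr (dotC x) -expr2.
Qed.

End Orthonormal.
End HilbertBasis.

(** * Sequences in $\mathcal H$ through their coordinate sequences *)

Section Coordinates.
Context {R : realType} {H : hilbertType R}.
Implicit Types (f g : l2 H) (x y : l2 R^o) (u v : H) (a : R).

Lemma coord_sum_le u f n :
  \sum_(0 <= k < n) `|dot u (f k)| ^+ 2 <= (`|u| * `|f|) ^+ 2.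
Proof.
apply: (@le_trans _ _ (\sum_(0 <= k < n) `|u| ^+ 2 * `|f k| ^+ 2)).
  apply: ler_sum => k _; rewrite -exprMn lerXn2r ?nnegrE ?mulr_ge0//.
  exact: norm_dot_le.
by rewrite -mulr_sumr exprMn ler_wpM2l ?sqr_ge0// l2_sum_le.
Qed.

Lemma coord_subproof u f : (fun k => dot u (f k) : R^o) \in @square_summable R R^o.
Proof.
apply: (@l2_bound R R^o _ ((`|u| * `|f|) ^+ 2)) => n; exact: coord_sum_le.
Qed.

(* [coord u] intertwines the operators induced on [l2 H] with the original
   operators on [l2 R], which reduces every question about them to [l2 R]. *)
Definition coord u f : l2 R^o := L2 (coord_subproof u f).

Lemma coordP a u f g : coord u (a *: f + g) = a *: coord u f + coord u g.
Proof. by apply: val_inj; apply: funext => k /=; rewrite dotDr dotZr. Qed.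

Lemma coord0 u : coord u 0 = 0.
Proof. by have := coordP (-1) u 0 0; rewrite scaler0 addr0 scaleN1r addNr. Qed.

Lemma coordB u f g : coord u (f - g) = coord u f - coord u g.
Proof. by rewrite addrC -scaleN1r coordP scaleN1r addrC. Qed.

Lemma coord_sum u (I : Type) (r : seq I) (F : I -> l2 H) :
  coord u (\sum_(i <- r) F i) = \sum_(i <- r) coord u (F i).
Proof.
elim: r => [|i r IHr]; first by rewrite !big_nil coord0.
by rewrite !big_cons -[F i]scale1r coordP IHr !scale1r.
Qed.

Lemma norm_coord_le u f : `|coord u f| <= `|u| * `|f|.
Proof.
apply: (@l2norm_le R R^o) => [|n]; first by rewrite mulr_ge0.
exact: coord_sum_le.
Qed.

Lemma cvg_coord (I : Type) (F : set_system I) {FF : Filter F} (f_ : I -> l2 H) f u :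
  f_ i @[i --> F] --> f -> coord u (f_ i) @[i --> F] --> coord u f.
Proof.
move=> /cvgrPdist_lt ff; apply/cvgrPdist_lt => e e0.
have u0 : 0 < `|u| + 1 by rewrite ltr_wpDl.
have := ff _ (divr_gt0 e0 u0); apply: filterS => i fi.
rewrite -coordB (le_lt_trans (norm_coord_le _ _))//.
apply: (@le_lt_trans _ _ ((`|u| + 1) * `|f - f_ i|)).
  by rewrite ler_wpM2r// lerDl.
by rewrite mulrC -ltr_pdivlMr.
Qed.

Lemma coord_eq f g : (forall u, coord u f = coord u g) -> f = g.
Proof.
move=> fg; apply: val_inj; apply: funext => k /=; apply: dot_eq => u.
by have /(congr1 (fun x => l2val x k)) := fg u.
Qed.

Lemma coord_bullet u v x : coord u (bullet v x) = dot u v *: x.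
Proof.
apply: val_inj; apply: funext => k /=; rewrite dotZr mulrC.
by rewrite /GRing.scale/=.
Qed.

Lemma is_cvg_bracket f x : cvgn (series (fun k => (x k : R) *: f k)).
Proof.
apply: normed_cvg.
have cxf : cvgn (series (fun k => `|x k| ^+ 2 + `|f k| ^+ 2)).
  rewrite (_ : series _ = series ((fun k => `|x k| ^+ 2) + (fun k => `|f k| ^+ 2)))//.
  by apply: is_cvg_seriesD; exact: l2_cvg.
apply: series_le_cvg cxf => k //=.
rewrite normrZ; have := sqr_ge0 (`|x k| - `|f k|).
have := sqr_ge0 `|x k|; have := sqr_ge0 `|f k|.
rewrite sqrrB !mulr2n; lra.
Qed.

Lemma dot_bracket u f x : dot u (bracket f x) = dot x (coord u f).
Proof.
have : dot u (series (fun k => (x k : R) *: f k) n) @[n --> \oo] --> dot u (bracket f x).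
  by apply: cvg_dotr; exact: is_cvg_bracket.
move=> /cvg_lim <-//.
congr (limn _); apply/funext => n; rewrite /series/= dot_sumr.
by apply: eq_bigr => k _; rewrite dotZr.
Qed.

(** [bullet v] is the adjoint of [coord v]. *)
Lemma dot_bullet v x f : dot (bullet v x) f = dot x (coord v f).
Proof.
congr (limn (series _)); apply/funext => k /=.
by rewrite dotZl.
Qed.

Lemma norm_bullet v x : `|bullet v x| = `|v| * `|x|.
Proof.
have : `|bullet v x| ^+ 2 = (`|v| * `|x|) ^+ 2.
  by rewrite -dot_norm dot_bullet coord_bullet dotZr !dot_norm exprMn.
move=> /(congr1 Num.sqrt); by rewrite !sqrtr_sqr !ger0_norm.
Qed.

Lemma bulletP a u v x : bullet (a *: u + v) x = a *: bullet u x + bullet v x.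
Proof.
apply: coord_eq => w; rewrite coordP !coord_bullet dotDr dotZr.
by rewrite scalerDl scalerA.
Qed.

Lemma bullet0 x : bullet (0 : H) x = 0.
Proof. by have := bulletP (-1) 0 0 x; rewrite scaler0 addr0 scaleN1r addNr. Qed.

Lemma bulletB u v x : bullet (u - v) x = bullet u x - bullet v x.
Proof. by rewrite addrC -scaleN1r bulletP scaleN1r addrC. Qed.

Lemma bullet_suml (I : Type) (r : seq I) (c : I -> R) (F : I -> H) x :
  bullet (\sum_(i <- r) c i *: F i) x = \sum_(i <- r) c i *: bullet (F i) x.
Proof.
elim: r => [|i r IHr]; first by rewrite !big_nil bullet0.
by rewrite !big_cons bulletP IHr.
Qed.

Lemma cvg_series_norm (K : hilbertType R) (f : l2 K) :
  \sum_(0 <= k < n) `|f k| ^+ 2 @[n --> \oo] --> `|f| ^+ 2.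
Proof.
rewrite (_ : (fun n => _) = series (fun k => dot (f k) (f k))); last first.
  by apply/funext => n; apply: eq_bigr => k _; rewrite dot_norm.
by rewrite -l2norm_sqr; exact: l2dot_cvg.
Qed.

Section Basis.
Variable h : nat -> H.
Hypothesis h_basis : orthonormal_basis h.

(** The finite double sum over coordinates and entries is rearranged and bounded entry by entry with
    Bessel's inequality in [H]; then the number of entries tends to infinity. *)
Lemma coord_bessel N f : \sum_(0 <= i < N) `|coord (h i) f| ^+ 2 <= `|f| ^+ 2.
Proof.
have cv : \sum_(0 <= i < N) \sum_(0 <= k < n) `|coord (h i) f k| ^+ 2 @[n --> \oo] -->
    \sum_(0 <= i < N) `|coord (h i) f| ^+ 2.
  by apply: cvg_sum_nat => i; exact: cvg_series_norm.
rewrite -(cvg_lim _ cv)//; apply: limr_le; first exact: cvgP cv.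
apply: nearW => n; rewrite exchange_big/=; apply: le_trans (l2_sum_le f n).
apply: ler_sum => k _; apply: le_trans (bessel h_basis N (f k)).
by apply: ler_sum => i _; rewrite real_normK ?num_real.
Qed.

(** The same double sum, now with the number of coordinates tending to infinity: Parseval's identity
    recovers each entry. *)
Lemma coord_le f (M : R) : 0 <= M ->
  (forall N, \sum_(0 <= i < N) `|coord (h i) f| ^+ 2 <= M ^+ 2) -> `|f| <= M.
Proof.
move=> M0 fM; apply: l2norm_le => // n.
have cv : \sum_(0 <= k < n) \sum_(0 <= i < N) dot (h i) (f k) ^+ 2 @[N --> \oo] -->
    \sum_(0 <= k < n) `|f k| ^+ 2.
  by apply: cvg_sum_nat => k; exact: parseval.
rewrite -(cvg_lim _ cv)//; apply: limr_le; first exact: cvgP cv.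
apply: nearW => N; rewrite exchange_big/=; apply: le_trans (fM N).
apply: ler_sum => i _; apply: le_trans (l2_sum_le (coord (h i) f) n).
by apply: ler_sum => k _; rewrite real_normK ?num_real.
Qed.

Lemma coord_parseval f :
  \sum_(0 <= i < N) `|coord (h i) f| ^+ 2 @[N --> \oo] --> `|f| ^+ 2.
Proof.
pose s N := \sum_(0 <= i < N) `|coord (h i) f| ^+ 2.
have nd : nondecreasing_seq s.
  by apply: nondecreasing_series => i _ _; exact: sqr_ge0.
have cs : cvgn s.
  by apply: nondecreasing_is_cvgn => //; exists (`|f| ^+ 2) => _ [N _ <-]; exact: coord_bessel.
suff <- : limn s = `|f| ^+ 2 by [].
have s0 : 0 <= limn s.
  apply: limr_ge => //; apply: nearW => N.
  by apply: sumr_ge0 => i _; exact: sqr_ge0.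
apply/eqP; rewrite eq_le; apply/andP; split.
  by apply: limr_le => //; apply: nearW => N; exact: coord_bessel.
rewrite -[limn s]sqr_sqrtr// lerXn2r ?nnegrE ?sqrtr_ge0//.
apply: coord_le; first exact: sqrtr_ge0.
by move=> N; rewrite sqr_sqrtr//; exact: nondecreasing_cvgn_le.
Qed.

Lemma dot_coord f g : \sum_(0 <= i < N) dot (coord (h i) f) (coord (h i) g)
  @[N --> \oo] --> dot f g.
Proof.
rewrite dot_polarization.
under eq_fun => N.
  under eq_bigr => i _ do rewrite dot_polarization -[coord _ f]scale1r -coordP !scale1r.
  rewrite -mulr_sumr !sumrB; over.
apply: cvgM; first exact: cvg_cst.
by apply: cvgB; [apply: cvgB|]; exact: coord_parseval.
Qed.

End Basis.

(** * Convergence and coordinates of induced operators *)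

Section InducedOperator.
Variables (h : nat -> H) (b : nat -> l2 R^o) (B : l2 R^o -> l2 R^o) (M : R).
Hypothesis h_basis : orthonormal_basis h.
Hypothesis b_basis : orthonormal_basis b.
Hypothesis BP : forall a x y, B (a *: x + y) = a *: B x + B y.
Hypothesis M0 : 0 <= M.
Hypothesis BM : forall x, `|B x| <= M * `|x|.

Let B0 : B 0 = 0.
Proof. by have := BP (-1) 0 0; rewrite scaler0 addr0 scaleN1r addNr. Qed.

Let B_sum (I : Type) (r : seq I) (c : I -> R) (F : I -> l2 R^o) :
  B (\sum_(i <- r) c i *: F i) = \sum_(i <- r) c i *: B (F i).
Proof.
elim: r => [|i r IHr]; first by rewrite !big_nil B0.
by rewrite !big_cons BP IHr.
Qed.

Let BB x y : B (x - y) = B x - B y.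
Proof. by rewrite addrC -scaleN1r BP scaleN1r addrC. Qed.

Let cvg_B (x_ : nat -> l2 R^o) x : x_ n @[n --> \oo] --> x -> B (x_ n) @[n --> \oo] --> B x.
Proof.
move=> /cvgrPdist_lt xx; apply/cvgrPdist_lt => e e0.
have m0 : 0 < M + 1 by rewrite ltr_wpDl.
have := xx _ (divr_gt0 e0 m0); apply: filterS => i xi.
rewrite -BB (le_lt_trans (BM _))//.
apply: (@le_lt_trans _ _ ((M + 1) * `|x - x_ i|)); first by rewrite ler_wpM2r// lerDl.
by rewrite mulrC -ltr_pdivlMr.
Qed.

Lemma norm_sum_orthonormal (c : nat -> R) m n :
  `|\sum_(m <= k < n) c k *: b k| ^+ 2 = \sum_(m <= k < n) c k ^+ 2.
Proof.
have bb i j : dot (b i) (b j) = (i == j)%:R by case: b_basis.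
rewrite -dot_norm dot_suml; apply: eq_big_nat => i /andP[mi ni].
rewrite dotZl dot_sumr (bigD1_seq i) ?mem_index_iota ?mi ?iota_uniq//=.
rewrite dotZr bb eqxx big1 => [|j ji]; first by rewrite addr0 mulr1 expr2.
by rewrite dotZr bb eq_sym (negbTE ji) mulr0.
Qed.

Let term f k : l2 H := bullet (bracket f (b k)) (B (b k)).

(** The norms of the terms are merely square summable, so absolute convergence may fail. Along
    [h i], however, a block of the series is [B] of an orthogonal sum; boundedness of [B] and
    Bessel's inequality over [i] give the estimate. *)
Let norm_term_le f m n : `|\sum_(m <= k < n) term f k| <=
  M * Num.sqrt (\sum_(m <= k < n) `|bracket f (b k)| ^+ 2).
Proof.
apply: (coord_le h_basis); first by rewrite mulr_ge0// sqrtr_ge0.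
move=> N; rewrite exprMn sqr_sqrtr; last by apply: sumr_ge0 => k _; exact: sqr_ge0.
apply: (@le_trans _ _ (\sum_(0 <= i < N) (M ^+ 2 *
    \sum_(m <= k < n) dot (h i) (bracket f (b k)) ^+ 2))).
  apply: ler_sum => i _; rewrite coord_sum.
  under eq_bigr do rewrite coord_bullet.
  rewrite -B_sum -norm_sum_orthonormal -exprMn.
  exact: (ler_sqr_mono (normr_ge0 _) (BM _)).
rewrite -mulr_sumr ler_wpM2l ?sqr_ge0// exchange_big/=.
by apply: ler_sum => k _; exact: bessel.
Qed.

Let bracket_summable f : cvgn (series (fun k => `|bracket f (b k)| ^+ 2)).
Proof.
apply: nondecreasing_is_cvgn.
  by apply: nondecreasing_series => i _ _; exact: sqr_ge0.
exists (`|f| ^+ 2) => _ [n _ <-].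
have cv : \sum_(0 <= k < n) \sum_(0 <= i < N) dot (h i) (bracket f (b k)) ^+ 2
    @[N --> \oo] --> \sum_(0 <= k < n) `|bracket f (b k)| ^+ 2.
  by apply: cvg_sum_nat => k; exact: parseval.
rewrite /series/= -(cvg_lim _ cv)//; apply: limr_le; first exact: cvgP cv.
apply: nearW => N; rewrite exchange_big/=; apply: le_trans (coord_bessel h_basis N f).
apply: ler_sum => i _; apply: le_trans (bessel b_basis n _).
by apply: ler_sum => k _; rewrite dot_bracket.
Qed.

Lemma is_cvg_induced_op f : cvgn (series (term f)).
Proof.
apply/cauchy_cvgP/cauchy_seriesP => e e0.
have M1 : 0 < M + 1 by rewrite ltr_wpDl.
have de : 0 < (e / (M + 1)) ^+ 2 by rewrite exprn_gt0// divr_gt0.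
have /cauchy_cvgP/cauchy_seriesP/(_ _ de) := @bracket_summable f.
apply: filterS => -[m n] /= small; apply: le_lt_trans (norm_term_le f m n) _.
have s0 : 0 <= \sum_(m <= k < n) `|bracket f (b k)| ^+ 2.
  by apply: sumr_ge0 => k _; exact: sqr_ge0.
move: small; rewrite (ger0_norm s0) -ltr_sqrt// sqrtr_sqr gtr0_norm ?divr_gt0// => small.
apply: (@le_lt_trans _ _ ((M + 1) * Num.sqrt (\sum_(m <= k < n) `|bracket f (b k)| ^+ 2))).
  by rewrite ler_wpM2r ?sqrtr_ge0// lerDl.
by rewrite mulrC -ltr_pdivlMr.
Qed.

(** Applied termwise, [coord u] turns the series into [B] of the expansion of [coord u f]. The
    right-hand side does not mention [b]: this is the independence of the basis. *)
Lemma coord_induced_op u f : coord u (induced_op b B f) = B (coord u f).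
Proof.
have cv1 : coord u (series (term f) n) @[n --> \oo] --> coord u (induced_op b B f).
  by apply: cvg_coord; exact: is_cvg_induced_op.
have cv2 : B (\sum_(0 <= k < n) dot (b k) (coord u f) *: b k) @[n --> \oo] -->
    B (coord u f).
  by apply: cvg_B; exact: orthonormal_expansion.
have E n : coord u (series (term f) n) =
    B (\sum_(0 <= k < n) dot (b k) (coord u f) *: b k).
  rewrite B_sum coord_sum; apply: eq_bigr => k _.
  by rewrite coord_bullet dot_bracket.
move: cv1; under eq_fun do rewrite E.
by move=> cv1; exact: (cvg_unique (@norm_hausdorff _ _) cv1 cv2).
Qed.

Lemma norm_induced_op_le f : `|induced_op b B f| <= M * `|f|.
Proof.
apply: (coord_le h_basis); first by rewrite mulr_ge0.
move=> N; rewrite exprMn.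
apply: (@le_trans _ _ (\sum_(0 <= i < N) M ^+ 2 * `|coord (h i) f| ^+ 2)).
  apply: ler_sum => i _; rewrite coord_induced_op -exprMn.
  exact: (ler_sqr_mono (normr_ge0 _) (BM _)).
by rewrite -mulr_sumr ler_wpM2l ?sqr_ge0// coord_bessel.
Qed.

End InducedOperator.
End Coordinates.

(** * The form $(\cdot,\cdot)_A$ and its finite-rank projections *)

Section InducedForm.
Context {R : realType} {H : hilbertType R}.
Variables (h : nat -> H) (b : nat -> l2 R^o) (A : {linear l2 R^o -> l2 R^o}).
Hypothesis h_basis : orthonormal_basis h.
Hypothesis b_basis : orthonormal_basis b.
Hypothesis A_bounded : bounded_operator A.
Hypothesis A_selfadjoint : self_adjoint A.
Hypothesis A_posdef : positive_definite A.
Implicit Types (f g : l2 H) (x y : l2 R^o).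

Lemma bounded_operator_ge0 : exists2 M : R, 0 <= M & forall x, `|A x| <= M * `|x|.
Proof.
have [M AM] := A_bounded; exists `|M| => // x.
by rewrite (le_trans (AM x))// ler_wpM2r// ler_norm.
Qed.

Let AP (a : R) x y : A (a *: x + y) = a *: A x + A y.
Proof. by rewrite linearP. Qed.

Lemma coord_induced_linear (u : H) f :
  coord u (induced_op b A f) = A (coord u f).
Proof.
have [M M0 AM] := bounded_operator_ge0.
exact: (coord_induced_op h_basis b_basis AP M0 AM).
Qed.

Lemma dotA_coord f g :
  \sum_(0 <= i < N) dot (coord (h i) f) (A (coord (h i) g)) @[N --> \oo] -->
  dotA (induced_op b A) f g.
Proof.
have := @dot_coord R H h h_basis f (induced_op b A g).
by under eq_fun do under eq_bigr do rewrite coord_induced_linear.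
Qed.

Lemma dotA_bullet (v : H) x g :
  dotA (induced_op b A) (bullet v x) g = dot x (A (coord v g)).
Proof. by rewrite /dotA dot_bullet coord_induced_linear. Qed.

(** All properties pass through coordinates. For positivity, a nonzero [f] has a nonzero coordinate
    by Parseval; its term is positive and the others are nonnegative. *)
Lemma dotA_inner_product : inner_product_on setT (dotA (induced_op b A : l2 H -> l2 H)).
Proof.
split=> [f g _ _|a f g z _ _ _|f _ f0].
- apply: (cvg_unique (@norm_hausdorff _ _) (@dotA_coord f g)).
  have := @dotA_coord g f.
  by under eq_fun do under eq_bigr do rewrite dotC A_selfadjoint.
- by rewrite /dotA dotPl.
have A0 x : 0 <= dot x (A x).
  have [->|/eqP x0] := eqVneq x 0; first by rewrite dot0l.
  exact/ltW/A_posdef.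
have [i fi0] : exists i, coord (h i) f <> 0.
  apply: contrapT => nf; apply: f0; apply/eqP; rewrite -normr_eq0 -sqrf_eq0.
  have := @coord_parseval R H h h_basis f; rewrite (_ : (fun N => _) = cst 0).
    by move=> /(cvg_unique (@norm_hausdorff _ _) (cvg_cst (0 : R))) ->.
  apply/funext => N; rewrite big1// => i _.
  have -> : coord (h i) f = 0 by apply: contrapT => fi; apply: nf; exists i.
  by rewrite normr0 expr0n.
have cv := @dotA_coord f f; rewrite -(cvg_lim _ cv)//.
have nd : nondecreasing_seq (fun N => \sum_(0 <= i < N) dot (coord (h i) f) (A (coord (h i) f))).
  by apply: nondecreasing_series => j _ _; exact: A0.
apply: lt_le_trans (nondecreasing_cvgn_le nd (cvgP _ cv) i.+1).
rewrite big_nat_recr//= ltr_wpDl//; last exact: A_posdef.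
by apply: sumr_ge0 => j _; exact: A0.
Qed.

Lemma dotA_bounded : exists2 M : R, 0 <= M &
  forall f, dotA (induced_op b A) f f <= M * `|f| ^+ 2.
Proof.
have [M M0 AM] := bounded_operator_ge0; exists M => // f.
apply: le_trans (ler_norm _) _; apply: le_trans (norm_dot_le _ _) _.
rewrite expr2 mulrCA ler_wpM2l//.
exact: (norm_induced_op_le h_basis b_basis AP M0 AM).
Qed.

Section Projection.
Variables (n : nat) (x : 'I_n -> l2 R^o) (P : l2 R^o -> l2 R^o).
Hypothesis x_orth : orthonormal_for A x.
Hypothesis P_proj : orthogonal_projection_for A x P.

Lemma projectionE y : P y = \sum_(k < n) dot (A (x k)) y *: x k.
Proof.
have [[c Pc] Pperp] := P_proj y; rewrite Pc; apply: eq_bigr => j _.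
have xj : in_span x (x j).
  exists (fun k => (k == j)%:R); rewrite (bigD1 j)//= eqxx scale1r.
  by rewrite big1 ?addr0// => k /negbTE ->; rewrite scale0r.
have := Pperp _ xj; rewrite /dotA dotBl Pc dot_suml (bigD1 j)//= dotZl.
rewrite [dot (x j) _](x_orth j j) eqxx mulr1 big1 => [|k kj]; last first.
  by rewrite dotZl [dot (x k) _](x_orth k j) (negbTE kj) mulr0.
by rewrite addr0 (dotC (A _)) => /eqP; rewrite subr_eq0 => /eqP ->.
Qed.

Lemma induced_projection f :
  induced_op b P f = \sum_(k < n) bullet (bracket f (A (x k))) (x k).
Proof.
(* [P] is given only by its orthogonality property; linearity and boundedness, which
   [coord_induced_op] asks for, are read off [projectionE]. *)
have PP (a : R) y z : P (a *: y + z) = a *: P y + P z.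
  rewrite !projectionE scaler_sumr -big_split/=; apply: eq_bigr => k _.
  by rewrite dotDr dotZr scalerDl scalerA.
have M0 : 0 <= \sum_(k < n) `|A (x k)| * `|x k|.
  by apply: sumr_ge0 => k _; rewrite mulr_ge0.
have PM y : `|P y| <= (\sum_(k < n) `|A (x k)| * `|x k|) * `|y|.
  rewrite projectionE (le_trans (ler_norm_sum _ _ _))// mulr_suml.
  apply: ler_sum => k _; rewrite normrZ mulrAC ler_wpM2r//.
  exact: norm_dot_le.
apply: coord_eq => u; rewrite (coord_induced_op h_basis b_basis PP M0 PM).
rewrite projectionE coord_sum; apply: eq_bigr => k _.
by rewrite coord_bullet dot_bracket.
Qed.

Lemma residual_orthogonal f (u : H) j : dotA (induced_op b A)
  (f - \sum_(k < n) bullet (bracket f (A (x k))) (x k)) (bullet u (x j)) = 0.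
Proof.
rewrite (ip_sym dotA_inner_product I I) dotA_bullet coordB coord_sum.
rewrite -A_selfadjoint dotBr dot_sumr (bigD1 j)//= coord_bullet dotZr.
rewrite (dotC (A (x j)) (x j)) [dot (x j) (A (x j))](x_orth j j) eqxx mulr1.
rewrite dot_bracket big1 ?addr0 ?subrr// => k kj.
rewrite coord_bullet dotZr (dotC _ (x k)).
by rewrite [dot (x k) _](x_orth k j) (negbTE kj) mulr0.
Qed.

End Projection.

End InducedForm.

(** * Density of $s(\mathcal N)$ in $\ell^2(\mathcal H)$ *)

Section Density.
Context {R : realType} {H : hilbertType R} (G : gelfand_triple H).

Lemma ipnorm_origin p : ipnorm (gt_ip G p) 0 = 0.
Proof.
have [N0 _] := gt_Np_sub G p; have := ip_lin (gt_Np_ip G p) (-1) N0 N0 N0.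
by rewrite scaler0 addr0 mulN1r addNr /ipnorm => ->; rewrite sqrtr0.
Qed.

(** Truncation makes every weighted series stationary from [N] on, however fast the norms of [y]
    grow. *)
Lemma finite_seq_s_pred (y : nat -> H) N : (forall k, gt_N G (y k)) ->
  (fun k => if (k < N)%N then y k else 0) \in s_pred G.
Proof.
move=> yN; apply/asboolP => p _; split=> [k|].
  by case: ifP => _; [exact/gt_N_Np/yN|have [] := gt_Np_sub G p].
apply/cvg_ex; exists (series (weighted_sq G p
  (fun k => if (k < N)%N then y k else 0)) N).
apply: cvg_near_cst; exists N => // n /= Nn.
rewrite /series/= (@big_cat_nat _ _ _ N 0 n)//= big_nat_cond.
rewrite [X in _ + X]big_nat_cond [X in _ + X]big1 ?addr0 -?big_nat_cond//.
move=> k /andP[/andP[Nk _] _].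
by rewrite /weighted_sq ltnNge Nk/= ipnorm_origin expr0n/= mulr0.
Qed.

Lemma sN_dense (f : l2 H) (eps : R) : 0 < eps ->
  exists phi : sN G, `|sN_l2 phi - f| <= eps.
Proof.
move=> eps0; have eps20 : 0 < eps ^+ 2 / 2 by rewrite divr_gt0// exprn_gt0.
have /cvgrPdist_le/(_ _ eps20) [N _ /(_ N (leqnn _)) /= tail] := @cvg_series_norm R H f.
(* [N] entries with error [delta] contribute at most $N\varepsilon^2/(4(N+1)^2)\le\varepsilon^2/2$,
   the tail the other half. The successor covers $N=0$. *)
pose delta := eps / (2 * N.+1%:R).
have N0 : 0 < N.+1%:R :> R by rewrite ltr0n.
have delta0 : 0 < delta by rewrite divr_gt0// mulr_gt0.
have dense k : exists y, gt_N G y /\ `|f k - y| < delta.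
  have [|y Ny] := @gt_N_dense _ _ G 0 (f k) delta _ delta0; first by rewrite gt_N0.
  rewrite /ipnorm gt_ip0 dot_norm sqrtr_sqr normr_id => fy.
  by exists y.
have [y yP] := choice dense.
pose phi := SN (finite_seq_s_pred N (fun k => (yP k).1)).
exists phi; apply: l2norm_le; first exact: ltW.
move=> n; apply: (@le_trans _ _ (\sum_(0 <= k < N + n) `|phi k - f k| ^+ 2)).
  rewrite addnC (@big_cat_nat _ _ _ n 0 (n + N)%N) ?leq_addr//= lerDl.
  by apply: sumr_ge0 => k _; exact: sqr_ge0.
rewrite (@big_cat_nat _ _ _ N 0 (N + n)%N) ?leq_addr//=.
have head : \sum_(0 <= k < N) `|phi k - f k| ^+ 2 <= eps ^+ 2 / 2.
  apply: (@le_trans _ _ (\sum_(0 <= k < N) delta ^+ 2)).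
    apply: ler_sum_nat => k /andP[_ kN]; rewrite /= kN distrC.
    by apply: ler_sqr_mono => //; exact/ltW/(yP k).2.
  rewrite sumr_const_nat subn0 -[_ *+ N]mulr_natr /delta.
  have NN : N%:R <= N.+1%:R :> R by rewrite ler_nat.
  have N1 : 1 <= N.+1%:R :> R by rewrite ler1n.
  move: N0 NN N1; move: N.+1%:R N%:R => z t z0 tz z1.
  have -> : (eps / (2 * z)) ^+ 2 * t = eps ^+ 2 / 2 * (t / (2 * z ^+ 2)).
    by field; rewrite gt_eqF.
  rewrite ler_piMr ?(ltW eps20)// ler_pdivrMr ?mulr_gt0 ?exprn_gt0//.
  by rewrite mul1r; nra.
have tl : \sum_(N <= k < N + n) `|phi k - f k| ^+ 2 <= eps ^+ 2 / 2.
  rewrite (@eq_big_nat _ _ _ _ _ _ (fun k => `|f k| ^+ 2)); last first.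
    by move=> k /andP[Nk _]; rewrite /= ltnNge Nk/= sub0r normrN.
  apply: le_trans tail; have := l2_sum_le f (N + n).
  rewrite (@big_cat_nat _ _ _ N 0 (N + n)%N) ?leq_addr//= => fle.
  by rewrite ger0_norm ?subr_ge0 ?l2_sum_le//; lra.
lra.
Qed.

End Density.

(** * The pairings $\langle f,\cdot\rangle$ as a Gaussian field *)

Section Pairing.
Context {R : realType} {H : hilbertType R} {G : gelfand_triple H}.
Variables (mu : probability (sN_dualM G) R) (AH : l2 H -> l2 H) (M : R).
Hypothesis AH_inner : inner_product_on setT (dotA AH).
Hypothesis M0 : 0 <= M.
Hypothesis AH_bounded : forall f, dotA AH f f <= M * `|f| ^+ 2.
Hypothesis mu_char : has_gaussian_char_fun mu AH.
Implicit Types (f g : l2 H) (phi psi : sN G).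

Local Notation q := (dotA AH).

Let qC f g : q f g = q g f. Proof. exact: (ip_sym AH_inner). Qed.

Let qP (a : R) f g z : q (a *: f + g) z = a * q f z + q g z.
Proof. exact: (ip_lin AH_inner). Qed.

Let q_ge0 f : 0 <= q f f. Proof. exact: (ip_ge0 AH_inner). Qed.

Let qsq (a : R) f g : q (a *: f + g) (a *: f + g) =
  a ^+ 2 * q f f + 2 * a * q f g + q g g.
Proof. by rewrite qP !(qC _ (a *: f + g)) !qP (qC g f); ring. Qed.

Let q0 z : q 0 z = 0.
Proof. by have := qP (-1) 0 0 z; rewrite scaler0 addr0 mulN1r addNr. Qed.

Let q_tri (a : R) f g : q (a *: f + g) (a *: f + g) <=
  2 * a ^+ 2 * q f f + 2 * q g g.
Proof.
have := q_ge0 (- a *: f + g); rewrite !qsq.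
by move: (q _ _) (q f f) (q g g) => c d e; lra.
Qed.

Let qB f g z : q (f - g) (f - g) <= 2 * q (f - z) (f - z) + 2 * q (g - z) (g - z).
Proof.
have -> : f - g = -1 *: (g - z) + (f - z) by rewrite scaleN1r opprB [RHS]addrC subrKA.
by apply: le_trans (q_tri _ _ _) _; lra.
Qed.

Lemma sN_l2P (a : R) phi psi : sN_l2 (a *: phi + psi) = a *: sN_l2 phi + sN_l2 psi.
Proof. exact: val_inj. Qed.

Lemma sN_l2B phi psi : sN_l2 (phi - psi) = sN_l2 phi - sN_l2 psi.
Proof. exact: val_inj. Qed.

Lemma dual_pairingP (a : R) phi psi (w : sN_dualM G) :
  dual_pairing (a *: phi + psi) w = a * dual_pairing phi w + dual_pairing psi w.
Proof. by rewrite /dual_pairing linearP. Qed.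

Lemma dual_pairingB phi psi (w : sN_dualM G) :
  dual_pairing (phi - psi) w = dual_pairing phi w - dual_pairing psi w.
Proof. by rewrite /dual_pairing linearB. Qed.

Lemma measurable_dual_pairing phi :
  measurable_fun setT (dual_pairing phi : sN_dualM G -> R).
Proof.
by move=> _ B mB; rewrite setTI; apply: sub_sigma_algebra; exists phi => //; exists B.
Qed.

Lemma dual_pairing_msq phi :
  (msq mu (dual_pairing phi) <= (q (sN_l2 phi) (sN_l2 phi))%:E)%E.
Proof.
apply: gaussian_msq_le => [|t]; first exact: measurable_dual_pairing.
transitivity (\int[mu]_w cos (dual_pairing (t *: phi) w))%R.
  by apply: eq_Rintegral => w _; rewrite /dual_pairing linearZ.
rewrite /Rintegral (mu_char (t *: phi)).1/=.
by rewrite -[t *: phi]addr0 sN_l2P qsq !(qC _ (sN_l2 0)) [sN_l2 0](_ : _ = 0) ?q0 ?mulr0 ?addr0//; exact: val_inj.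
Qed.

Lemma sN_dense_form f (e : R) : 0 < e ->
  exists phi, q (sN_l2 phi - f) (sN_l2 phi - f) <= e.
Proof.
move=> e0; have M1 : 0 < M + 1 by rewrite ltr_wpDl.
have d0 : 0 < Num.sqrt (e / (M + 1)) by rewrite sqrtr_gt0 divr_gt0.
have [phi phif] := sN_dense G f d0; exists phi.
apply: le_trans (AH_bounded _) _.
have sE : Num.sqrt (e / (M + 1)) ^+ 2 = e / (M + 1).
  by rewrite sqr_sqrtr// ltW// divr_gt0.
have := ler_sqr_mono (normr_ge0 _) phif; rewrite sE.
move=> /(ler_wpM2l M0) /le_trans; apply.
by rewrite mulrA ler_pdivrMr// mulrC ler_wpM2l ?(ltW e0)// lerDl.
Qed.

Lemma pairing_exists f : exists X, is_pairing mu AH f X.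
Proof.
have e0 k : 0 < (1 / 4) ^+ k / 4 :> R by rewrite divr_gt0// exprn_gt0// divr_gt0.
have [phi phiP] := choice (fun k => sN_dense_form f (e0 k)).
have mphi k := measurable_dual_pairing (phi k).
have cauchy k m : (k <= m)%N -> (msq mu (fun w => dual_pairing (phi m) w -
    dual_pairing (phi k) w)%R <= ((1 / 4) ^+ k)%:E)%E.
  move=> km; rewrite -(@eq_msq _ _ _ mu (dual_pairing (phi m - phi k))); last first.
    by move=> w; rewrite dual_pairingB.
  apply: le_trans (dual_pairing_msq _) _; rewrite lee_fin sN_l2B.
  apply: le_trans (qB _ _ f) _.
  have mk : (1 / 4) ^+ m <= (1 / 4) ^+ k :> R by apply: ler_wiXn2l => //; lra.
  by have := phiP m; have := phiP k; lra.
(* The sub-$\sigma$-algebra is here the whole one, generated by the cylinder sets. *)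
have [Y [mY YP]] := 
  @riesz_fischer _ (sN_dualM G) R mu (@cylinder_sets _ _ G) _ (fun D SD => SD) mphi cauchy.
have cvg4 : (1 / 4) ^+ k @[k --> \oo] --> (0 : R).
  by apply: cvg_expr; rewrite ger0_norm; lra.
exists Y; split.
  apply/Lfun2P; split=> //.
  rewrite (@eq_msq _ _ _ mu _ (fun w => (Y w - dual_pairing (phi 0%N) w) +
    dual_pairing (phi 0%N) w)); last by move=> w; rewrite subrK.
  apply: le_lt_trans (msqD mu _ _) _ => //; first exact: measurable_funB.
  apply: (@le_lt_trans _ _ (2%:E * ((1 / 4) ^+ 0)%:E +
    2%:E * (q (sN_l2 (phi 0%N)) (sN_l2 (phi 0%N)))%:E)%E).
    by apply: leeD; rewrite lee_pmul2l ?lte_fin//; exact: dual_pairing_msq.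
  by rewrite -!EFinM -EFinD ltry.
exists phi; split.
  apply/cvgrPdist_le => e e0'; have e20 : 0 < e ^+ 2 by rewrite exprn_gt0.
  move/cvgrPdist_le : cvg4 => /(_ _ e20); apply: filterS => k.
  rewrite !sub0r !normrN !ger0_norm ?sqrtr_ge0 ?exprn_ge0 ?divr_ge0// => ke.
  rewrite -[e]gtr0_norm// -sqrtr_sqr ler_wsqrtr// (le_trans (phiP k))//.
  by rewrite (le_trans _ ke)// ler_piMr ?exprn_ge0//; lra.
apply/Lnorm2_cvg0P => e e0'.
move/cvgrPdist_le : cvg4 => /(_ _ e0'); apply: filterS => k.
rewrite sub0r normrN ger0_norm ?exprn_ge0 ?divr_ge0// => ke.
rewrite (_ : msq _ _ = msq mu (fun w => Y w - dual_pairing (phi k) w)%R).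
  by apply: le_trans (YP k) _; rewrite lee_fin.
by rewrite msqBC.
Qed.

Lemma pairingP f : is_pairing mu AH f (pairing mu AH f).
Proof.
have [X PX] := pairing_exists f.
exact: (@xgetPex _ (cst 0) [set X | is_pairing mu AH f X] (ex_intro _ X PX)).
Qed.

Lemma measurable_pairing f : measurable_fun setT (pairing mu AH f).
Proof. by have [/Lfun2P[]] := pairingP f. Qed.

Lemma pairing_approx f (e : R) : 0 < e -> exists phi,
  q (sN_l2 phi - f) (sN_l2 phi - f) <= e /\
  (msq mu (fun w => pairing mu AH f w - dual_pairing phi w)%R <= e%:E)%E.
Proof.
move=> e0; have [_ [phi [phif /Lnorm2_cvg0P/(_ _ e0) phiX]]] := pairingP f.
have se0 : 0 < Num.sqrt e by rewrite sqrtr_gt0.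
move/cvgrPdist_le : phif => /(_ _ se0) phif.
have [k [fk Xk]] := filter_ex (filterI phif phiX).
exists (phi k); split; last by rewrite msqBC.
move: fk; rewrite /= sub0r normrN ger0_norm ?sqrtr_ge0// => fk.
have := ler_sqr_mono (sqrtr_ge0 _) fk.
by rewrite !sqr_sqrtr ?q_ge0// ltW.
Qed.

(** The three pairings are limits along unrelated sequences. One approximant of each is compared,
    since on $s(\mathcal N)$ the pairing is exactly linear and its second moment is bounded by the
    form. *)
Lemma pairing_linear (a : R) f g : pairing mu AH (a *: f + g) =
  (fun w => a * pairing mu AH f w + pairing mu AH g w) %[ae mu].
Proof.
have mp := measurable_pairing; have md := measurable_dual_pairing.
have mL (X Y : sN_dualM G -> R) : measurable_fun setT X -> measurable_fun setT Y ->
    measurable_fun setT (fun w => a * X w + Y w).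
  by move=> mX mY; apply: measurable_funD => //; exact: measurable_funM.
have mLp := mL _ _ (mp f) (mp g).
suff : (fun w => pairing mu AH (a *: f + g) w -
    (a * pairing mu AH f w + pairing mu AH g w)) = cst 0 %[ae mu].
  by apply: filterS => w Xw Iw; apply/eqP; rewrite -subr_eq0 Xw.
apply: msq_small_ae0; first exact: measurable_funB.
move=> e e0.
(* [C] collects the factors of two nested triangle inequalities: 2 for [chiX], then 4 times the
   constants of [S2] and [S3]. *)
pose C : R := 2 + 4 * (2 + 4 * a ^+ 2 + 4) + 4 * (2 * a ^+ 2 + 2).
have C0 : 0 < C by have := sqr_ge0 a; rewrite /C; lra.
pose d := e / C; have d0 : 0 < d by rewrite divr_gt0.
have [phi [phif phiX]] := pairing_approx f d0.
have [psi [psig psiX]] := pairing_approx g d0.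
have [chi [chih chiX]] := pairing_approx (a *: f + g) d0.
have mLd := mL _ _ (md phi) (md psi).
have S2 : (msq mu (fun w => dual_pairing chi w -
    (a * dual_pairing phi w + dual_pairing psi w))%R <=
    ((2 + 4 * a ^+ 2 + 4) * d)%:E)%E.
  rewrite -(@eq_msq _ _ _ mu (dual_pairing (chi - (a *: phi + psi)))); last first.
    by move=> w; rewrite dual_pairingB dual_pairingP.
  apply: le_trans (dual_pairing_msq _) _; rewrite lee_fin sN_l2B sN_l2P.
  apply: le_trans (qB _ _ (a *: f + g)) _.
  rewrite (_ : a *: sN_l2 phi + sN_l2 psi - (a *: f + g) =
    a *: (sN_l2 phi - f) + (sN_l2 psi - g)); last first.
    by rewrite scalerBr opprD addrACA.
  have := q_tri a (sN_l2 phi - f) (sN_l2 psi - g).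
  have := ler_wpM2l (sqr_ge0 a) phif.
  by move: chih psig phif; move: (q _ _) (q _ _) (q _ _) (q _ _) => *; lra.
have S3 : (msq mu (fun w => (a * dual_pairing phi w + dual_pairing psi w) -
    (a * pairing mu AH f w + pairing mu AH g w))%R <=
    ((2 * a ^+ 2 + 2) * d)%:E)%E.
  rewrite (@eq_msq _ _ _ mu _ (fun w => a * (dual_pairing phi w - pairing mu AH f w) +
    (dual_pairing psi w - pairing mu AH g w))); last by move=> w; ring.
  apply: le_trans (msqD mu _ _) _.
  - by apply: measurable_funM => //; exact: measurable_funB.
  - exact: measurable_funB.
  - rewrite msqZ; last exact: measurable_funB.
    have -> : ((2 * a ^+ 2 + 2) * d)%:E =
        (2%:E * ((a ^+ 2)%:E * d%:E) + 2%:E * d%:E)%E.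
      by rewrite -!EFinM -EFinD; congr EFin; ring.
    apply: leeD; rewrite lee_pmul2l ?lte_fin//.
      by rewrite msqBC lee_wpmul2l ?lee_fin ?sqr_ge0.
    by rewrite msqBC.
apply: le_trans (msqB_triangle mu (mp _) (md chi) mLp) _.
have S1 := msqB_triangle mu (md chi) mLd mLp.
have two0 : (0 < 2%:E :> \bar R)%E by rewrite lte_fin.
apply: (@le_trans _ _ (2%:E * d%:E + 2%:E * (2%:E * ((2 + 4 * a ^+ 2 + 4) * d)%:E +
    2%:E * ((2 * a ^+ 2 + 2) * d)%:E))%E).
  apply: leeD; rewrite lee_pmul2l//; apply: le_trans S1 _.
  by apply: leeD; rewrite lee_pmul2l.
rewrite -!(EFinM, EFinD) lee_fin.
have -> : e = C * d by rewrite mulrC divfK// gt_eqF.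
by rewrite /C; lra.
Qed.

(** For a bounded 1-Lipschitz [F], convergence in $L^2$ carries $\int F$ to the limit. The value [l]
    depends on the approximants only through their form norms, which tend to that of [f]. *)
Lemma pairing_char_approx f (F : R -> R) (l : R) :
  measurable_fun setT F -> (forall x, `|F x| <= 1) ->
  (forall x y, `|F x - F y| <= `|x - y|) ->
  (forall phi : nat -> sN G, q (sN_l2 (phi n)) (sN_l2 (phi n)) @[n --> \oo] --> q f f ->
     (\int[mu]_w F (dual_pairing (phi n) w))%R @[n --> \oo] --> l) ->
  (\int[mu]_w F (pairing mu AH f w) = l)%R.
Proof.
move=> mF F1 FL phil; have [_ [phi [phif /Lnorm2_cvg0P phiX]]] := pairingP f.
have mFX X : measurable_fun setT X -> measurable_fun setT (fun w : sN_dualM G => F (X w)).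
  by move=> mX; exact: (measurableT_comp mF).
have iF X : measurable_fun setT X ->
    mu.-integrable setT (EFin \o (fun w : sN_dualM G => F (X w))).
  by move=> mX; apply: (@integrable_bounded _ _ _ _ _ 1) => //; exact: mFX.
have mp := measurable_pairing f; have md := measurable_dual_pairing.
apply: (cvg_unique (@norm_hausdorff _ _) _ (phil phi _)).
- apply/cvgrPdist_le => e e0; have e20 : 0 < e ^+ 2 by rewrite exprn_gt0.
  have := phiX _ e20; apply: filterS => n Xn.
  rewrite -RintegralB//; try exact: iF.
  have iB : mu.-integrable setT (EFin \o (fun w => F (pairing mu AH f w) - F (dual_pairing (phi n) w))).
    apply: (@integrable_bounded _ _ _ _ _ 2); first by apply: measurable_funB; exact: mFX.
    move=> w; rewrite (le_trans (ler_normB _ _))//.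
    by have := F1 (pairing mu AH f w); have := F1 (dual_pairing (phi n) w); lra.
  rewrite (le_trans (le_normr_Rintegral _ _))// -lee_fin fineK; last first.
    exact: (integrable_fin_num measurableT (integrable_norm iB)).
  apply: le_trans (integral_abs_le_msq e0 _ Xn); last exact: measurable_funB.
  apply: ge0_le_integral => //.
  + apply/measurable_EFinP; apply: measurableT_comp => //.
    by apply: measurable_funB; exact: mFX.
  + by apply/measurable_EFinP; apply: measurableT_comp => //; exact: measurable_funB.
  + by move=> w _; rewrite lee_fin (le_trans (FL _ _))// distrC.
- have nE g : q g g = normA AH g ^+ 2 by rewrite sqr_sqrtr.
  rewrite nE; under eq_fun do rewrite nE expr2.
  have cn : normA AH (sN_l2 (phi n)) @[n --> \oo] --> normA AH f.
    apply/cvgrPdist_le => e e0; move/cvgrPdist_le : phif => /(_ _ e0).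
    apply: filterS => n; rewrite sub0r normrN ger0_norm ?sqrtr_ge0// => phin.
    rewrite ler_norml; apply/andP; split.
      have := ipnormD AH_inner (sN_l2 (phi n) - f) f; rewrite subrK.
      by move: phin; rewrite /normA -!/(ipnorm _ _); lra.
    have := ipnormD AH_inner (f - sN_l2 (phi n)) (sN_l2 (phi n)); rewrite subrK.
    have -> : ipnorm q (f - sN_l2 (phi n)) = ipnorm q (sN_l2 (phi n) - f).
      by rewrite -opprB -scaleN1r ipnormZ// normrN1 mul1r.
    by move: phin; rewrite /normA -!/(ipnorm _ _); lra.
  by rewrite expr2; exact: cvgM.
Qed.

Lemma pairing_cos f : (\int[mu]_w cos (pairing mu AH f w) = expR (- q f f / 2))%R.
Proof.
apply: pairing_char_approx => //.
- by apply: continuous_measurable_fun; exact: continuous_cos.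
- exact: cos_max.
- exact: dist_cos_le.
move=> phi phif; rewrite /Rintegral; under eq_fun do rewrite (mu_char _).1/=.
have qn : - q (sN_l2 (phi n)) (sN_l2 (phi n)) / 2 @[n --> \oo] --> - q f f / 2.
  by apply: cvgM; [exact: cvgN|exact: cvg_cst].
exact: (cvg_comp _ _ qn (@continuous_expR R _)).
Qed.

Lemma pairing_sin f : (\int[mu]_w sin (pairing mu AH f w) = 0)%R.
Proof.
apply: pairing_char_approx => //.
- by apply: continuous_measurable_fun; exact: continuous_sin.
- exact: sin_max.
- exact: dist_sin_le.
move=> phi phif; rewrite /Rintegral; under eq_fun do rewrite (mu_char _).2/=.
exact: cvg_cst.
Qed.

End Pairing.

(** * Conditioning on finitely many directions *)

Section BulletDense.
Context {R : realType} {H : hilbertType R}.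
Variable h : nat -> H.
Hypothesis h_basis : orthonormal_basis h.

(** Each [u k] is replaced by a finite combination of the [h i]. Halving the tolerance at every [k]
    makes the length of [r] irrelevant. *)
Lemma bullet_dense (K : Type) (y : K -> l2 R^o) (u : K -> H) (r : seq K) (d : R) :
  0 < d -> exists s : seq (R * (nat * K)),
    `|\sum_(j <- s) j.1 *: bullet (h j.2.1) (y j.2.2) -
      \sum_(k <- r) bullet (u k) (y k)| <= d.
Proof.
elim: r d => [|k r IHr] d d0.
  by exists [::]; rewrite !big_nil subr0 normr0 ltW.
have d20 : 0 < d / 2 by rewrite divr_gt0.
have [s sr] := IHr _ d20.
have y1 : 0 < `|y k| + 1 by rewrite ltr_wpDl.
have dy0 : 0 < d / 2 / (`|y k| + 1) by rewrite divr_gt0.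
have [_ _ /(_ (u k) _ I dy0) [n [c]]] := h_basis.
rewrite /ipnorm dot_norm sqrtr_sqr normr_id => uc.
exists ([seq (c i, (i, k)) | i <- index_iota 0 n] ++ s).
rewrite big_cat big_cons big_map/= -bullet_suml opprD addrACA (splitr d).
rewrite (le_trans (ler_normD _ _))// lerD//.
rewrite -bulletB norm_bullet distrC big_mkord.
apply: (@le_trans _ _ (d / 2 / (`|y k| + 1) * (`|y k| + 1))).
  by apply: ler_pM => //; [exact: ltW|rewrite lerDl].
by rewrite divfK// gt_eqF.
Qed.

End BulletDense.

Section ConditionalExpectation.
Context {R : realType} {H : hilbertType R} {G : gelfand_triple H}.
Variables (h : nat -> H) (b : nat -> l2 R^o) (A : {linear l2 R^o -> l2 R^o}).
Hypothesis h_basis : orthonormal_basis h.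
Hypothesis b_basis : orthonormal_basis b.
Hypothesis A_bounded : bounded_operator A.
Hypothesis A_selfadjoint : self_adjoint A.
Hypothesis A_posdef : positive_definite A.
Variable mu : probability (sN_dualM G) R.
Hypothesis mu_char : has_gaussian_char_fun mu (induced_op b A).

Let AH : l2 H -> l2 H := induced_op b A.

Let AH_inner : inner_product_on setT (dotA AH).
Proof. exact: dotA_inner_product h_basis b_basis A_bounded A_selfadjoint A_posdef. Qed.

Let lin (a : R) (f g : l2 H) : pairing mu AH (a *: f + g) =
  (fun w => a * pairing mu AH f w + pairing mu AH g w) %[ae mu].
Proof.
have [M M0 AM] := dotA_bounded h_basis b_basis A_bounded.
exact: (pairing_linear AH_inner M0 AM mu_char).
Qed.

Let mX (f : l2 H) : measurable_fun setT (pairing mu AH f).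
Proof.
have [M M0 AM] := dotA_bounded h_basis b_basis A_bounded.
exact: (measurable_pairing AH_inner M0 AM mu_char).
Qed.

Let qC (f g : l2 H) : dotA AH f g = dotA AH g f.
Proof. exact: (ip_sym AH_inner). Qed.

Let qP (a : R) (f g z : l2 H) : dotA AH (a *: f + g) z = a * dotA AH f z + dotA AH g z.
Proof. exact: (ip_lin AH_inner). Qed.

Lemma pairing_sum n (F : 'I_n -> l2 H) : pairing mu AH (\sum_(k < n) F k) =
  (fun w => \sum_(k < n) pairing mu AH (F k) w) %[ae mu].
Proof.
have := gaussian_field_sum lin F [seq (1, k) | k <- index_enum 'I_n].
rewrite big_map; under eq_bigr do rewrite scale1r.
apply: filterS => w Xw Iw; rewrite Xw// big_map.
by apply: eq_bigr => k _; rewrite mul1r.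
Qed.

Lemma direction_cond_exp_pairing (f : l2 H) n (x : 'I_n -> l2 R^o) :
  orthonormal_for A x -> direction_cond_exp mu AH h x (pairing mu AH f) =
    (fun w => \sum_(k < n)
       pairing mu AH (bullet (bracket f (A (x k))) (x k)) w) %[ae mu].
Proof.
move=> x_orth; have [M M0 AM] := dotA_bounded h_basis b_basis A_bounded.
have Xcos := pairing_cos AH_inner M0 AM mu_char.
have Xsin := pairing_sin AH_inner M0 AM mu_char.
pose e (j : nat * 'I_n) : l2 H := bullet (h j.1) (x j.2).
pose p := \sum_(k < n) bullet (bracket f (A (x k))) (x k).
have pf : p + (f - p) = f by rewrite addrC subrK.
have := @gaussian_field_cond_exp _ _ _ mu _ _ _ qC qP mX lin Xcos Xsin _ e p (f - p)
  [set S | exists (i : nat) (k : 'I_n), exists2 B : set R, measurable B &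
     S = pairing mu AH (bullet (h i) (x k)) @^-1` B].
rewrite pf => Econd.
apply: filterS2 (Econd _ _ _) (pairing_sum (fun k => bullet (bracket f (A (x k))) (x k))).
- by move=> w E1 E2 Iw; rewrite -E2// -E1.
- move=> j; exact: (residual_orthogonal h_basis b_basis A_bounded A_selfadjoint A_posdef x_orth).
- move=> S; split=> [[i [k [B mB ->]]]|[[i k] [B [mB ->]]]].
    by exists (i, k), B.
  by exists i, k, B.
- move=> eps eps0; have M1 : 0 < M + 1 by rewrite ltr_wpDl.
  have d0 : 0 < Num.sqrt (eps / (M + 1)) by rewrite sqrtr_gt0 divr_gt0.
  have [s sP] := bullet_dense h_basis x (fun k => bracket f (A (x k))) (index_enum 'I_n) d0.
  exists s; apply: le_trans (AM _) _.
  have sE : Num.sqrt (eps / (M + 1)) ^+ 2 = eps / (M + 1).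
    by rewrite sqr_sqrtr// ltW// divr_gt0.
  have := ler_sqr_mono (normr_ge0 _) sP; rewrite sE.
  move=> /(ler_wpM2l M0) /le_trans; apply.
  by rewrite mulrA ler_pdivrMr// mulrC ler_wpM2l ?(ltW eps0)// lerDl.
Qed.

End ConditionalExpectation.

Theorem theorem3p15 (R : realType) (H : hilbertType R)
    (Hsep : separable H) (Hinf : infinite_dimensional H)
    (G : gelfand_triple H)
    (h : nat -> H) (h_basis : orthonormal_basis h)
    (b : nat -> l2 R^o) (b_basis : orthonormal_basis b)
    (A : {linear l2 R^o -> l2 R^o}) (A_bounded : bounded_operator A)
    (A_selfadjoint : self_adjoint A) (A_posdef : positive_definite A)
    (mu : probability (sN_dualM G) R)
    (mu_char : has_gaussian_char_fun mu (induced_op b A))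
    (f : l2 H) (n : nat) (n_gt0 : (0 < n)%N)
    (x : 'I_n -> l2 R^o) (x_orth : orthonormal_for A x)
    (P : l2 R^o -> l2 R^o) (P_proj : orthogonal_projection_for A x P) :
  let AH := induced_op b A in
  let E := fun (m : nat) (y : 'I_m -> l2 R^o) =>
    direction_cond_exp mu AH h y (pairing mu AH f) in
  [/\ E n x = (fun w => \sum_(k < n)
                 pairing mu AH (bullet (bracket f (A (x k))) (x k)) w) %[ae mu],
      (fun w => \sum_(k < n)
         pairing mu AH (bullet (bracket f (A (x k))) (x k)) w) =
        pairing mu AH (induced_op b P f) %[ae mu] &
      E n x = (fun w => \sum_(k < n) E 1%N (fun=> x k) w) %[ae mu]].
Proof.
move=> AH E.
have condE m (y : 'I_m -> l2 R^o) : orthonormal_for A y -> E m y =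
    (fun w => \sum_(k < m)
       pairing mu AH (bullet (bracket f (A (y k))) (y k)) w) %[ae mu].
  exact: direction_cond_exp_pairing.
have En := condE n x x_orth; split=> //.
- rewrite (induced_projection h_basis b_basis x_orth P_proj).
  have := pairing_sum h_basis b_basis A_bounded A_selfadjoint A_posdef mu_char
    (fun k => bullet (bracket f (A (x k))) (x k)).
  by apply: filterS => w Xw Iw; rewrite Xw.
(* A single [x k] is itself an orthonormal family, so the first claim applies to it. *)
- have E1 k : E 1%N (fun=> x k) =
      (fun w => pairing mu AH (bullet (bracket f (A (x k))) (x k)) w) %[ae mu].
    have xk : @orthonormal_for _ _ A 1 (fun=> x k).
      by move=> i j; rewrite !ord1 eqxx; have := x_orth k k; rewrite eqxx.
    by apply: filterS (condE _ _ xk) => w Ew Iw; rewrite Ew// big_ord1.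
  (* The finitely many exceptional sets are merged so that the sums can be compared pointwise. *)
  have E1s : \forall w \ae mu, forall k, E 1%N (fun=> x k) w =
      pairing mu AH (bullet (bracket f (A (x k))) (x k)) w.
    by apply: filter_forall => k; apply: filterS (E1 k) => w; apply.
  by apply: filterS2 En E1s => w -> // E1w Iw; apply: eq_bigr => k _; rewrite E1w.
Qed.
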